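(* Let $P_0=N(0,I_d)$ be the standard Gaussian on $\mathbb{R}^d$ and let $k(x,y)=\exp(-\gamma\|x-y\|_2^2)$ with $\gamma>0$. Then $\operatorname{tr}(C_\star)=(1+2\gamma)d$, and \[ \operatorname{tr}(C_\star^2)=(1+8\gamma)^{-d/2}\frac{d}{(1+8\gamma)^2}\Bigl[(64\gamma^4+32\gamma^3+4\gamma^2)d+128\gamma^4+128\gamma^3+80\gamma^2+16\gamma+1\Bigr]. \]
   Context: For a distribution $P_0$ on $\mathbb{R}^d$ with continuously differentiable, everywhere positive density $p_0$, the score is $s_0(x)=\nabla\log p_0(x)$. For a kernel $k$ with reproducing kernel Hilbert space $\mathcal{H}_k$, the Langevin--Stein feature map is $\xi_{P_0}(x):=s_0(x)k(x,\cdot)+\nabla_xk(x,\cdot)\in\mathcal{H}:=\mathcal{H}_k^d$. The Stein covariance operator is $C_\star:=\mathbb{E}_{P_0}[\xi_{P_0}(X)\otimes\xi_{P_0}(X)]$ on $\mathcal{H}$, where $a\otimes b$ is the operator $x\mapsto\langle b,x\rangle a$. *)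

(* Defs.v *)
From HB Require Import structures.
From mathcomp Require Import all_boot all_order all_algebra.
From mathcomp Require Import all_classical all_reals all_analysis.

Set Implicit Arguments.
Unset Strict Implicit.
Unset Printing Implicit Defensive.

Import Order.TTheory GRing.Theory Num.Theory.
Import numFieldNormedType.Exports.

Local Open Scope classical_set_scope.
Local Open Scope ring_scope.

(* R^n is 'rV[R]_n, for its normed space structure (used by 'D_v), here given
   the product sigma-algebra, i.e. the one generated by the coordinates. *)
Section row_measurable.
Context {d} {T : measurableType d} (n : nat).

Let coord (i : 'I_n) (x : 'rV[T]_n) : T := x ord0 i.

Let row_set0 : g_sigma_preimage coord set0.
Proof. exact: sigma_algebra0. Qed.

Let row_setC A : g_sigma_preimage coord A -> g_sigma_preimage coord (~` A).
Proof. exact: sigma_algebraC. Qed.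

Let row_bigcup (F : (set 'rV[T]_n)^nat) :
  (forall i, g_sigma_preimage coord (F i)) ->
  g_sigma_preimage coord (\bigcup_i F i).
Proof. exact: sigma_algebra_bigcup. Qed.

HB.instance Definition _ := @isMeasurable.Build (measure_tuple_display d)
  'rV[T]_n (g_sigma_preimage coord) row_set0 row_setC row_bigcup.

Lemma measurable_coord (i : 'I_n) :
  measurable_fun [set: 'rV[T]_n] (fun x => x ord0 i).
Proof.
move=> _ Y mY; rewrite setTI; apply: sub_sigma_algebra => /=.
rewrite -bigcup_seq/=; exists i => /=; first by rewrite mem_index_enum.
by exists Y => //; rewrite setTI.
Qed.

End row_measurable.

Lemma measurable_fun_row d d' (S : measurableType d) (T : measurableType d') n
    (f : S -> 'rV[T]_n) :
  (forall i, measurable_fun [set: S] (fun s => f s ord0 i)) ->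
  measurable_fun [set: S] f.
Proof.
move=> mf; have : g_sigma_preimage
    (fun i => (fun x : 'rV[T]_n => x ord0 i) \o f) `<=` measurable.
  apply: smallest_sub; first exact: sigma_algebra_measurable.
  case: n => [|n] in f mf *; first by rewrite big_ord0.
  rewrite -bigcup_mkord_ord; apply: bigcup_sub => i Ii.
  by move=> A [B mB <-]; exact: mf.
rewrite g_sigma_preimage_comp => prefS.
by move=> _ A mA; apply: prefS; exists A.
Qed.

Section standard_gaussian.
Context {R : realType}.

Definition row_cons n (tx : measurableTypeR R * 'rV[R]_n) : 'rV[R]_n.+1 :=
  \row_i (if unlift ord0 i is Some j then tx.2 ord0 j else tx.1).

Lemma measurable_row_cons n :
  measurable_fun [set: measurableTypeR R * 'rV[R]_n] (@row_cons n).
Proof.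
apply: measurable_fun_row => i; rewrite /row_cons.
case: (unliftP ord0 i) => [j ->|->]; last first.
  by under eq_fun do rewrite mxE unlift_none; exact: measurable_fst.
under eq_fun do rewrite mxE liftK.
exact: (measurableT_comp (measurable_coord j)).
Qed.

HB.instance Definition _ n :=
  isMeasurableFun.Build _ _ _ _ (@row_cons n) (@measurable_row_cons n).

(* N(0, I_n), as the n-fold product of N(0, 1); std_gaussian_box below
   characterizes it and exhibits std_gaussian_pdf as its density. *)
Fixpoint std_gaussian n : probability 'rV[R]_n R :=
  if n is m.+1 then
    distribution (normal_prob (0 : R) 1 \x std_gaussian m)%E (@row_cons m)
  else \d_(0 : 'rV[R]_0).

Lemma std_gaussian_box n (A : 'I_n -> set R) : (forall i, measurable (A i)) ->
  std_gaussian n [set x | forall i, A i (x ord0 i)] =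
  (\prod_(i < n) normal_prob (0 : R) 1 (A i))%E.
Proof.
elim: n A => [|n IH] A mA /=.
  rewrite big_ord0 diracE mem_set// => -[]//.
rewrite /distribution /pushforward/=.
set B := (X in (_ \x _)%E X).
have -> : B = (A ord0 : set (measurableTypeR R)) `*`
    [set x : 'rV[R]_n | forall i, A (lift ord0 i) (x ord0 i)].
  apply/seteqP; split=> [[t x] /= tx|[t x] /= [t0 tx] i].
    split; first by have := tx ord0; rewrite mxE unlift_none.
    by move=> i; have := tx (lift ord0 i); rewrite mxE liftK.
  by rewrite mxE; case: (unliftP ord0 i) => [j|] ->.
rewrite product_measure1E//=; last first.
  rewrite (_ : mkset _ = \bigcap_(i in [set: 'I_n])
      ((fun x : 'rV[R]_n => x ord0 i) @^-1` A (lift ord0 i))); last first.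
    by apply/seteqP; split=> [x /= xA i _|x /= xA i]; [exact: xA|exact: xA].
  apply: fin_bigcap_measurable => [|i _]; first exact: finite_finset.
  by rewrite -[_ @^-1` _]setTI; apply: measurable_coord => //; exact: mA.
  exact: (mA ord0).
rewrite big_ord_recl; congr (_ * _)%E.
by apply: (IH (fun i => A (lift ord0 i))) => i; exact: mA.
Qed.

End standard_gaussian.

Section euclidean.
Context {R : realType} (n : nat).
Implicit Types x y : 'rV[R]_n.

(* The library norm `|x| on 'rV[R]_n is the sup norm. *)
Definition norm2 x : R := Num.sqrt (\sum_i x ord0 i ^+ 2).

Definition gaussian_kernel (gamma : R) x y : R :=
  expR (- gamma * norm2 (x - y) ^+ 2).

Definition grad (f : 'rV[R]_n -> R) x : 'rV[R]_n :=
  \row_i 'D_(delta_mx ord0 i) f x.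

Definition score (p : 'rV[R]_n -> R) : 'rV[R]_n -> 'rV[R]_n :=
  grad (fun x => ln (p x)).

Definition std_gaussian_pdf x : R := \prod_i normal_pdf 0 1 (x ord0 i).

End euclidean.

(* Real reproducing kernel Hilbert spaces: the elements are functions on X
   through the injection rkhs_fun. *)
Structure rkhs (R : realType) (X : Type) (k : X -> X -> R) := Rkhs {
  rkhs_space :> completeNormedModType R;
  rkhs_dot : {dot rkhs_space for idfun};
  rkhs_dot_norm : forall f, rkhs_dot f f = `|f| ^+ 2;
  rkhs_fun : rkhs_space -> X -> R;
  rkhs_fun_lin : forall a f g x,
    rkhs_fun (a *: f + g) x = a * rkhs_fun f x + rkhs_fun g x;
  rkhs_fun_inj : injective rkhs_fun;
  rkhs_section : X -> rkhs_space;
  rkhs_sectionE : forall x, rkhs_fun (rkhs_section x) = k x;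
  rkhs_reproducing : forall f x, rkhs_fun f x = rkhs_dot f (rkhs_section x) }.

Section operators.
Context {R : realType} (V : lmodType R) (dot : V -> V -> R).
Implicit Types (S T C : V -> V) (B : set V).

Definition bounded_operator T :=
  linear T /\ exists M, forall x, dot (T x) (T x) <= M * dot x x.

Definition positive_operator T := [/\ bounded_operator T,
  forall x y, dot (T x) y = dot x (T y) & forall x, 0 <= dot (T x) x].

(* Orthonormal bases in the Hilbert sense: maximal orthonormal sets. *)
Definition orthonormal_basis B := [/\ forall e, B e -> dot e e = 1,
  forall e e', B e -> B e' -> e <> e' -> dot e e' = 0 &
  forall x, (forall e, B e -> dot x e = 0) -> x = 0].

(* The operator S below is |T|, as S ^ 2 = T^* T. *)
Definition trace_class T := bounded_operator T /\ exists S,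
  [/\ positive_operator S, forall x y, dot (S x) (S y) = dot (T x) (T y) &
      exists2 B, orthonormal_basis B &
        (\esum_(e in B) (dot (S e) e)%:E < +oo)%E].

Definition is_trace T (t : R) := trace_class T /\
  forall B, orthonormal_basis B ->
    let u := fun e => (dot (T e) e)%:E in
    (\esum_(e in B) u^\+ e - \esum_(e in B) u^\- e = t%:E)%E.

Definition tensor (a b : V) : V -> V := fun x => dot b x *: a.

(* C = E_P[F] for the random operator F, in the weak sense:
   <f, C g> = E_P[<f, F g>] for all f and g. *)
Definition is_operator_expectation d (X : measurableType d)
    (P : probability X R) (F : X -> V -> V) C :=
  bounded_operator C /\ forall f g,
    P.-integrable setT (fun x => (dot f (F x g))%:E) /\
    ('E_P[fun x => dot f (F x g)] = (dot f (C g))%:E)%E.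

End operators.

Section stein.
Context {R : realType} (d : nat) (k : 'rV[R]_d -> 'rV[R]_d -> R) (H : rkhs k).

(* The element of the RKHS with underlying function u (0 if there is none). *)
Definition rkhs_lift (u : 'rV[R]_d -> R) : H :=
  xget 0 [set h : H | rkhs_fun h = u].

(* H ^ d is {ffun 'I_d -> H}, with the direct sum inner product. *)
Definition rkhs_pow_dot (f g : {ffun 'I_d -> H}) : R :=
  \sum_i rkhs_dot H (f i) (g i).

Definition stein_feature (p : 'rV[R]_d -> R) (x : 'rV[R]_d) :
    {ffun 'I_d -> H} :=
  [ffun i => rkhs_lift (fun y =>
     score p x ord0 i * k x y + grad (k ^~ y) x ord0 i)].

Definition is_stein_covariance (P : probability 'rV[R]_d R)
    (p : 'rV[R]_d -> R) (C : {ffun 'I_d -> H} -> {ffun 'I_d -> H}) :=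
  is_operator_expectation rkhs_pow_dot P
    (fun x => tensor rkhs_pow_dot (stein_feature p x) (stein_feature p x)) C.

End stein.

(* Main.v *)
(* Write xi for the Stein feature of x. The weak integral
   C = E[xi (x) xi] exists by the Riesz theorem, because (f, g) |->
   E[<f, xi><xi, g>] is a bounded form as soon as E|xi|^2 is finite. For an
   orthonormal basis (e_n), which is countable since H is separable, Parseval
   under the expectation gives
     tr C = sum_n E<e_n, xi>^2 = E|xi|^2,
     tr C^2 = sum_n E[<xi, e_n><C xi, e_n>] = E<xi, C xi>
            = E_x E_y <xi(x), xi(y)>^2,
   the second interchange being dominated through Bessel's inequality by a
   multiple of |xi|^2.

   The partial derivatives of x |-> k(x, .) exist in H as limits of difference
   quotients, so xi(x)_i = - x_i k(x, .) + d_i k(x, .) and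
     <xi(x), xi(y)> = k(x, y) sum_i p(x_i, y_i),
     p(u, v) = u v - (2 gamma + 4 gamma^2) (u - v)^2 + 2 gamma.
   Its square is a sum over (i, j) of products over the coordinates l of
   p^m(x_l, y_l) exp(- 2 gamma (x_l - y_l)^2) with m = [l = i] + [l = j], whose
   expectations are Gaussian moments of order at most four. *)

Require Import Defs.
From mathcomp Require Import all_boot all_order all_algebra.
From mathcomp Require Import all_classical all_reals all_analysis.
From mathcomp Require Import measurable_realfun ring lra.

Set Implicit Arguments.
Unset Strict Implicit.
Unset Printing Implicit Defensive.

Import Order.TTheory GRing.Theory Num.Theory.
Import numFieldNormedType.Exports.

Local Open Scope classical_set_scope.
Local Open Scope ring_scope.

Lemma cvg_of_sqr_le (R : realType) (f g : nat -> R) l :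
  (forall n, (f n - l) ^+ 2 <= g n) ->
  g n @[n --> \oo] --> (0 : R) -> f n @[n --> \oo] --> l.
Proof.
move=> fg g0; apply/cvgrPdist_lt => e e0.
have e2 : 0 < e ^+ 2 by rewrite exprn_gt0.
move/cvgrPdist_lt : g0 => /(_ _ e2); apply: filterS => n.
rewrite sub0r normrN => h.
rewrite distrC -(ltr_pXn2r (n := 2))// ?nnegrE ?(ltW e0)// real_normK
  ?num_real//.
exact: le_lt_trans (le_lt_trans (ler_norm _) h).
Qed.

Lemma sum_ordB (W : zmodType) (F : nat -> W) m n : (m <= n)%N ->
  \sum_(i < n) F i - \sum_(i < m) F i = \sum_(m <= i < n) F i.
Proof.
move=> mn; rewrite -!(big_mkord xpredT F) (big_cat_nat (n := m))//=.
by rewrite addrAC subrr add0r.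
Qed.

(** * Hilbert spaces *)

(** Phrased through the inner product alone, completeness included, so that it covers both [H] and
    its power [{ffun 'I_d -> H}]. *)
Record hilbert_dot (R : realType) (V : lmodType R) (dot : V -> V -> R) : Prop :=
  HilbertDot {
  hdotC : forall x y, dot x y = dot y x;
  hdotP : forall a x y z, dot (a *: x + y) z = a * dot x z + dot y z;
  hdot_ge0 : forall x, 0 <= dot x x;
  hdot_eq0 : forall x, dot x x = 0 -> x = 0;
  hdot_complete : forall u : nat -> V,
    (forall e, 0 < e -> exists N, forall m n, (N <= m)%N -> (N <= n)%N ->
       dot (u m - u n) (u m - u n) < e) ->
    exists l, dot (u n - l) (u n - l) @[n --> \oo] --> (0 : R) }.

Section hilbert.
Context {R : realType} (V : lmodType R) (dot : V -> V -> R).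
Hypothesis Hd : hilbert_dot dot.
Implicit Types (x y z : V) (B : set V).

Lemma hdotDl x y z : dot (x + y) z = dot x z + dot y z.
Proof. by rewrite -[x]scale1r (hdotP Hd) mul1r scale1r. Qed.

Lemma hdot0l z : dot 0 z = 0.
Proof. by apply: (addrI (dot 0 z)); rewrite -hdotDl !addr0. Qed.

Lemma hdotZl a x z : dot (a *: x) z = a * dot x z.
Proof. by rewrite -[a *: x]addr0 (hdotP Hd) hdot0l addr0. Qed.

Lemma hdotNl x z : dot (- x) z = - dot x z.
Proof. by rewrite -scaleN1r hdotZl mulN1r. Qed.

Lemma hdotBl x y z : dot (x - y) z = dot x z - dot y z.
Proof. by rewrite hdotDl hdotNl. Qed.

Lemma hdot0r z : dot z 0 = 0. Proof. by rewrite (hdotC Hd) hdot0l. Qed.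

Lemma hdotDr x y z : dot z (x + y) = dot z x + dot z y.
Proof. by rewrite (hdotC Hd) hdotDl !(hdotC Hd z). Qed.

Lemma hdotZr a x z : dot z (a *: x) = a * dot z x.
Proof. by rewrite (hdotC Hd) hdotZl (hdotC Hd z). Qed.

Lemma hdotBr x y z : dot z (x - y) = dot z x - dot z y.
Proof. by rewrite (hdotC Hd) hdotBl !(hdotC Hd z). Qed.

Lemma hdot_suml I (r : seq I) (P : pred I) (F : I -> V) z :
  dot (\sum_(i <- r | P i) F i) z = \sum_(i <- r | P i) dot (F i) z.
Proof.
by apply: (big_morph (dot^~ z)) => [x y|]; [exact: hdotDl|exact: hdot0l].
Qed.

Lemma hdot_sumr I (r : seq I) (P : pred I) (F : I -> V) z :
  dot z (\sum_(i <- r | P i) F i) = \sum_(i <- r | P i) dot z (F i).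
Proof. by rewrite (hdotC Hd) hdot_suml; apply: eq_bigr => i _;
  exact: hdotC. Qed.

Lemma hdot_ext x y : (forall z, dot z x = dot z y) -> x = y.
Proof.
move=> xy; apply/eqP; rewrite -subr_eq0; apply/eqP/(hdot_eq0 Hd).
by rewrite hdotBr xy subrr.
Qed.

Lemma hdot_CauchySchwarz x y : dot x y ^+ 2 <= dot x x * dot y y.
Proof.
have [->|y0] := eqVneq y 0; first by rewrite !hdot0r expr2 mulr0 mulr0.
have yy : 0 < dot y y.
  rewrite lt_neqAle (hdot_ge0 Hd) andbT eq_sym.
  by apply: contra_neq y0; exact: hdot_eq0.
have := hdot_ge0 Hd (dot y y *: x - dot x y *: y).
rewrite hdotBl !hdotBr !hdotZl !hdotZr (hdotC Hd y x).
rewrite (_ : _ - _ = dot y y * (dot x x * dot y y - dot x y ^+ 2));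
  last by ring.
by rewrite pmulr_rge0// subr_ge0.
Qed.

Lemma hdot_CauchySchwarz_norm x y :
  `|dot x y| <= Num.sqrt (dot x x) * Num.sqrt (dot y y).
Proof.
rewrite -sqrtr_sqr -sqrtrM ?(hdot_ge0 Hd)// ler_wsqrtr//.
exact: hdot_CauchySchwarz.
Qed.

Lemma hdot_cvg (u : nat -> V) l y :
  dot (u n - l) (u n - l) @[n --> \oo] --> (0 : R) ->
  dot (u n) y @[n --> \oo] --> dot l y.
Proof.
move=> ul; apply: (cvg_of_sqr_le (g := fun n => dot (u n - l) (u n - l) * dot y
  y)).
  by move=> n; rewrite -hdotBl; exact: hdot_CauchySchwarz.
by rewrite -[X in _ --> X](mul0r (dot y y)); exact: cvgMl.
Qed.

(** Expanding [dot (u m - u n) (u m - u n)] gives two diagonal terms minus twice the mixed one; all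
    are close to [L], so they cancel and the sequence is Cauchy. This yields strong convergence of
    difference quotients from kernel values only. *)
Lemma hdot_cvg_of_mixed (u : nat -> V) (L : R) :
  (forall e, 0 < e -> exists N, forall m n, (N <= m)%N -> (N <= n)%N ->
     `|dot (u m) (u n) - L| < e) ->
  exists l, dot (u n - l) (u n - l) @[n --> \oo] --> (0 : R).
Proof.
move=> uL; apply: (hdot_complete Hd) => e e0.
have [|N hN] := uL (e / 4); first by rewrite divr_gt0.
exists N => m n Nm Nn.
have := hN _ _ Nm Nm; have := hN _ _ Nm Nn; have := hN _ _ Nn Nn.
rewrite hdotBl !hdotBr (hdotC Hd (u n) (u m)) !ltr_norml.
by move=> /andP[? ?] /andP[? ?] /andP[? ?]; lra.
Qed.

End hilbert.

(* Some of the vectors may vanish: this allows enumerating finite sets. *)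
Definition orthonormal_seq (R : realType) (V : lmodType R) (dot : V -> V -> R)
    (e : nat -> V) :=
  (forall m n, m != n -> dot (e m) (e n) = 0) /\
  (forall n, e n = 0 \/ dot (e n) (e n) = 1).

(** * Orthonormal sequences: Bessel, Riesz-Fischer, Parseval and Riesz representation *)

Section orthonormal_sequences.
Context {R : realType} (V : lmodType R) (dot : V -> V -> R).
Hypothesis Hd : hilbert_dot dot.
Variable e : nat -> V.
Hypothesis one : orthonormal_seq dot e.

Section combinations.
Variable a : nat -> R.
Hypothesis a0 : forall n, e n = 0 -> a n = 0.

Local Notation S N := (\sum_(n < N) a n *: e n).

(** Zero members of the sequence carry zero coefficients, so pairing with [e m] recovers [a m] even
    where [e m = 0]. *)
Lemma dot_combination N m : dot (S N) (e m) = if (m < N)%N then a m else 0.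
Proof.
have [oe ne] := one.
rewrite (hdot_suml Hd); case: ltnP => mN.
  rewrite (bigD1 (Ordinal mN))//= big1 ?addr0.
    rewrite (hdotZl Hd); case: (ne m) => [em|->]; last by rewrite mulr1.
    by rewrite a0// mul0r.
  move=> i im; rewrite (hdotZl Hd) oe ?mulr0//.
apply: big1 => i _; rewrite (hdotZl Hd) oe ?mulr0//.
by rewrite neq_ltn (leq_trans (ltn_ord i)).
Qed.

Lemma dot_combinationr N x : dot x (S N) = \sum_(n < N) a n * dot x (e n).
Proof.
by rewrite (hdot_sumr Hd); apply: eq_bigr => i _; rewrite (hdotZr Hd).
Qed.

Lemma norm_combination M N : (M <= N)%N ->
  dot (S N - S M) (S N - S M) = \sum_(M <= n < N) a n ^+ 2.
Proof.
move=> MN; rewrite (sum_ordB (fun n => a n *: e n) MN).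
rewrite (hdot_sumr Hd) [LHS]big_nat [RHS]big_nat;
  apply: eq_bigr => m /andP[Mm mN].
have -> : \sum_(M <= n < N) a n *: e n = S N - S M.
  exact/esym/(sum_ordB (fun n => a n *: e n)).
by rewrite (hdotZr Hd) (hdotBl Hd) !dot_combination mN ltnNge Mm subr0.
Qed.

(** Riesz-Fischer: the bounded monotone sums of [a n ^+ 2] converge, and by Pythagoras their
    increments are the squared distances between partial combinations. *)
Lemma cvg_combination M : (forall N, \sum_(n < N) a n ^+ 2 <= M) ->
  exists l, dot (S n - l) (S n - l) @[n --> \oo] --> (0 : R).
Proof.
move=> aM; apply: (hdot_complete Hd) => eps eps0.
pose s N := \sum_(n < N) a n ^+ 2.
have nds : nondecreasing_seq s.
  move=> m n mn; rewrite -subr_ge0 /s (sum_ordB (fun n => a n ^+ 2) mn).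
  by apply: sumr_ge0 => i _; exact: sqr_ge0.
have cs : cvgn s.
  by apply: nondecreasing_is_cvgn => //; exists M => _ [N _ <-]; exact: aM.
have /cvgrPdist_lt /(_ _ eps0) := cs => -[N _ hN].
have sle n : s n <= limn s by exact: nondecreasing_cvgn_le.
have key m n : (N <= m)%N -> (m <= n)%N ->
    dot (S n - S m) (S n - S m) < eps.
  move=> Nm mn; rewrite norm_combination//.
  have -> : \sum_(m <= k < n) a k ^+ 2 = s n - s m.
    exact/esym/(sum_ordB (fun n => a n ^+ 2)).
  have := hN _ Nm; rewrite /= ger0_norm ?subr_ge0// => h.
  by apply: le_lt_trans h; rewrite lerD2r.
exists N => m n Nm Nn; have [mn|/ltnW nm] := leqP m n; last exact: key.
by rewrite -opprB (hdotNl Hd) (hdotC Hd) (hdotNl Hd) opprK; exact: key.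
Qed.

End combinations.

Lemma bessel x N : \sum_(n < N) dot x (e n) ^+ 2 <= dot x x.
Proof.
pose a n := dot x (e n).
have a0 n : e n = 0 -> a n = 0 by move=> en; rewrite /a en (hdot0r Hd).
pose S := \sum_(n < N) a n *: e n.
have := hdot_ge0 Hd (x - S).
rewrite (hdotBl Hd) !(hdotBr Hd) (hdotC Hd S x).
have -> : dot x S = \sum_(n < N) a n ^+ 2.
  by rewrite (dot_combinationr a).
suff -> : dot S S = \sum_(n < N) a n ^+ 2 by rewrite subrr subr0 subr_ge0.
have := @norm_combination a a0 0 N (leq0n _).
by rewrite big_ord0 subr0 big_mkord.
Qed.

Hypothesis te : forall x, (forall n, dot x (e n) = 0) -> x = 0.

(** Bessel makes the expansion converge to some [l]; [x - l] is orthogonal to every [e m], hence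
    zero by totality. *)
Lemma cvg_expansion x :
  let S n := \sum_(i < n) dot x (e i) *: e i in
  dot (S n - x) (S n - x) @[n --> \oo] --> (0 : R).
Proof.
move=> S; pose a n := dot x (e n).
have a0 n : e n = 0 -> a n = 0 by move=> en; rewrite /a en (hdot0r Hd).
have [l Sl] := cvg_combination a0 (bessel x).
suff -> : x = l by [].
apply/eqP; rewrite -subr_eq0; apply/eqP/te => m.
rewrite (hdotBl Hd); apply/eqP; rewrite subr_eq0; apply/eqP.
apply: (norm_cvg_unique _ (hdot_cvg Hd (y := e m) Sl)).
apply: cvg_near_cst; exists m.+1 => // n /= mn.
by rewrite dot_combination// mn.
Qed.

Lemma parseval x y :
  \sum_(i < n) dot x (e i) * dot y (e i) @[n --> \oo] --> dot x y.
Proof.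
have := hdot_cvg Hd (y := y) (cvg_expansion x); apply: cvg_trans.
apply: near_eq_cvg; apply: nearW => n.
by rewrite (hdotC Hd) (dot_combinationr (fun i => dot x (e i)));
  apply: eq_bigr => i _; rewrite mulrC.
Qed.

(** The representer is the sum of [phi (e n) *: e n]. Its coefficients are square summable:
    evaluating [phi] at a partial sum of squared norm [s] gives [s ^+ 2 <= M * s]. The bound on
    [phi] then passes the identity to the limit along the expansion of [x]. *)
Lemma riesz (phi : V -> R) M : 0 <= M ->
  (forall a x y, phi (a *: x + y) = a * phi x + phi y) ->
  (forall x, phi x ^+ 2 <= M * dot x x) ->
  exists w, forall x, phi x = dot x w.
Proof.
move=> M0 lin bnd.
have phi0 : phi 0 = 0.
  by have := lin 1 0 0; rewrite scaler0 addr0 mul1r => h;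
    apply: (addrI (phi 0)); rewrite -h addr0.
have phiZ a x : phi (a *: x) = a * phi x by rewrite -[a *: x]addr0 lin phi0
  addr0.
have phi_sum n (F : nat -> V) : phi (\sum_(i < n) F i) = \sum_(i < n) phi (F i).
  apply: (big_morph phi) => // x y.
  by rewrite -[x]scale1r lin mul1r scale1r.
have phiB x y : phi (x - y) = phi x - phi y.
  by rewrite addrC -scaleN1r lin mulN1r addrC.
pose a n := phi (e n).
have a0 n : e n = 0 -> a n = 0 by move=> en; rewrite /a en.
have aM N : \sum_(n < N) a n ^+ 2 <= M.
  pose s := \sum_(n < N) a n ^+ 2.
  have s0 : 0 <= s by apply: sumr_ge0 => i _; exact: sqr_ge0.
  pose S := \sum_(n < N) a n *: e n.
  have pS : phi S = s.
    by rewrite /S (phi_sum _ (fun n => a n *: e n)); apply: eq_bigr => i _;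
      rewrite phiZ.
  have SS : dot S S = s.
    have := @norm_combination a a0 0 N (leq0n _).
    by rewrite big_ord0 subr0 big_mkord.
  have := bnd S; rewrite pS SS expr2.
  change (s * s <= M * s -> s <= M).
  have [s00 _|sn0] := eqVneq s 0;
    last by rewrite ler_pM2r// lt_neqAle eq_sym sn0.
  by rewrite s00.
have [w Sw] := cvg_combination a0 aM.
exists w => x.
have E : (fun n => phi (\sum_(i < n) dot x (e i) *: e i)) =
    (fun n => dot (\sum_(i < n) a i *: e i) x).
  apply/funext => n; rewrite (phi_sum _ (fun i => dot x (e i) *: e i)).
  rewrite (hdotC Hd) (dot_combinationr a); apply: eq_bigr => i _.
  by rewrite phiZ mulrC.
have := hdot_cvg Hd (y := x) Sw; rewrite -E (hdotC Hd w) => lw.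
apply: (norm_cvg_unique _ lw).
pose r n := \sum_(i < n) dot x (e i) *: e i - x.
apply: (cvg_of_sqr_le (g := fun n => M * dot (r n) (r n))).
  by move=> n; rewrite -phiB; exact: bnd.
by rewrite -[X in _ --> X](mulr0 M); apply: cvgMr; exact: cvg_expansion.
Qed.

End orthonormal_sequences.

(** * Existence, countability and enumeration of orthonormal bases *)

Section orthonormal_bases.
Context {R : realType} (V : lmodType R) (dot : V -> V -> R).
Hypothesis Hd : hilbert_dot dot.

(** Zorn's lemma gives an orthonormal set maximal for inclusion; a nonzero vector orthogonal to it
    could be normalised and adjoined. *)
Lemma exists_orthonormal_basis : exists B, orthonormal_basis dot B.
Proof.
pose P (B : set V) := (forall e, B e -> dot e e = 1) /\
  (forall e e', B e -> B e' -> e <> e' -> dot e e' = 0).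
have [|A [[A1 A0] Amax]] := @Zorn_bigcup V P.
  move=> F FP Ft; split=> [e [X FX Xe]|e e' [X FX Xe] [Y FY Ye'] ee'].
    by have [+ _] := FP _ FX; apply.
  have [XY|YX] := Ft _ _ FX FY.
    by have [_ /(_ e e')] := FP _ FY; apply => //; exact: XY.
  by have [_ /(_ e e')] := FP _ FX; apply => //; exact: YX.
exists A; split => // x xA; apply: contrapT => /eqP x0.
have xx : 0 < dot x x.
  rewrite lt_neqAle (hdot_ge0 Hd) andbT eq_sym.
  by apply: contra_neq x0; exact: hdot_eq0.
pose y := (Num.sqrt (dot x x))^-1 *: x.
have yA e : A e -> dot y e = 0 by move=> Ae;
  rewrite (hdotZl Hd) (xA _ Ae) mulr0.
have yy : dot y y = 1.
  rewrite (hdotZl Hd) (hdotZr Hd) mulrA -invfM -expr2 sqr_sqrtr ?ltW//.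
  by rewrite mulVf// gt_eqF.
apply: (Amax (A `|` [set y])).
  split; first by move=> e Ae; left.
  move=> /(_ y (or_intror erefl)) Ay.
  by have := yA _ Ay; rewrite yy => /eqP; rewrite oner_eq0.
split=> [e [/A1//|->//]|e e' [Ae|->] [Ae'|->] ee'] //.
- exact: A0.
- by rewrite (hdotC Hd) yA.
- by rewrite yA.
Qed.

(* By Bessel's inequality each q n is orthogonal to all but countably many
   members of the basis, and no member is orthogonal to every q n. *)
Lemma orthonormal_basis_countable (q : nat -> V) B :
  (forall x, (forall n, dot x (q n) = 0) -> x = 0) ->
  orthonormal_basis dot B -> countable B.
Proof.
move=> sep [B1 B0 _].
suff -> : B = \bigcup_(n in [set: nat]) \bigcup_(k in [set: nat])
    [set e | B e /\ k.+1%:R^-1 < dot (q n) e ^+ 2].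
  apply: bigcup_countable => // n _; apply: bigcup_countable => // k _.
  apply: finite_set_countable; apply: contrapT => infB.
  have ex N : exists s : seq V, [/\ uniq s, size s = N &
      forall e, e \in s -> B e /\ k.+1%:R^-1 < dot (q n) e ^+ 2].
    elim: N => [|N [s [us sN sB]]]; first by exists [::].
    have /infinite_setN0[x [Bx xs]] := infinite_setD infB (finite_seq s).
    exists (x :: s); split => /=; first by rewrite us andbT; apply/negP.
      by rewrite sN.
    by move=> e; rewrite inE => /predU1P[->//|/sB].
  (* Chosen so that [N] squared coefficients above [k.+1%:R^-1] add up to more than
     [dot (q n) (q n)], against Bessel. *)
  pose N := (Num.trunc (dot (q n) (q n) * k.+1%:R)).+1.
  have [s [us sN sB]] := ex N.
  have one : orthonormal_seq dot (nth 0 s).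
    split=> [i j ij|i]; last first.
      have [si|si] := leqP (size s) i; first by left; rewrite nth_default.
      by right; apply: B1; exact: (sB _ (mem_nth _ si)).1.
    have [si|si] := leqP (size s) i; first by rewrite nth_default// (hdot0l Hd).
    have [sj|sj] := leqP (size s) j;
      first by rewrite (nth_default _ sj) (hdot0r Hd).
    apply: B0; [exact: (sB _ (mem_nth _ si)).1|exact: (sB _ (mem_nth _ sj)).1|].
    by apply/eqP; rewrite nth_uniq.
  have := bessel Hd one (q n) N; apply/negP; rewrite -ltNge.
  apply: (@lt_le_trans _ _ (N%:R * k.+1%:R^-1)).
    by rewrite ltr_pdivlMr// /N; exact: truncnS_gt.
  rewrite -[N in N%:R](card_ord N) mulr_natl -sumr_const.
  apply: ler_sum => i _; apply: ltW; apply: (sB _ _).2.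
  by rewrite mem_nth// sN.
apply/seteqP; split=> [e Be|e [n _ [k _ []]]//].
have [n] : exists n, dot e (q n) <> 0.
  apply: contrapT => /forallNP h; have e0 : e = 0.
    by apply: sep => n; exact: contrapT (h n).
  by have := B1 _ Be; rewrite e0 (hdot0l Hd) => /esym/eqP; rewrite oner_eq0.
move=> /eqP en; exists n => //; exists (Num.trunc (dot (q n) e ^+ 2)^-1) => //.
split => //; have e2 : 0 < dot (q n) e ^+ 2.
  by rewrite exprn_even_gt0//= (hdotC Hd).
rewrite invf_plt ?posrE//; exact: truncnS_gt.
Qed.

Lemma orthonormal_basis_enum B : countable B -> orthonormal_basis dot B ->
  exists e : nat -> V, [/\ orthonormal_seq dot e,
    forall x, (forall n, dot x (e n) = 0) -> x = 0 &
    forall a : V -> \bar R, (forall x, (0 <= a x)%E) -> a 0 = 0%E ->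
      (\esum_(x in B) a x = \sum_(n <oo) a (e n))%E].
Proof.
move=> /countable_injP[f finj] [B1 B0 Bt].
(* Indices outside the range of [f] receive the padding vector [0]; the condition [a 0 = 0] makes
   them contribute nothing to the series. *)
pose e n := xget 0 [set x | B x /\ f x = n].
have ef x : B x -> e (f x) = x.
  move=> Bx; apply: xget_unique => // y [By fyx].
  by apply: finj => //; rewrite inE.
have eP n : (e n = 0 /\ forall x, B x -> f x <> n) \/ (B (e n) /\ f (e n) = n).
  rewrite /e; case: xgetP => [y _ ?|h]; first by right.
  by left; split=> // x Bx fx; apply: (h x).
exists e; split.
- split=> [m n mn|n]; last by have [[]|[/B1]] := eP n; [left|right].
  have [[-> _]|[Bm fm]] := eP m; first by rewrite (hdot0l Hd).
  have [[-> _]|[Bn fn]] := eP n; first by rewrite (hdot0r Hd).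
  by apply: B0 => // emn; move/negP : mn; apply; rewrite -fm -fn emn.
- by move=> x xe; apply: Bt => y By; rewrite -(ef y By).
- move=> a a0 a00; rewrite nneseries_esumT//.
  transitivity (\esum_(n in f @` B) a (e n))%E.
    rewrite esum_image; last by move=> x y xB yB; exact: finj.
    by apply: eq_esum => x Bx; rewrite ef.
  rewrite esum_mkcond; apply: eq_esum => n _.
  case: ifPn => //; rewrite notin_setE => nB.
  have [[-> _]|[Bn fn]] := eP n; first by rewrite a00.
  by exfalso; apply: nB; exists (e n).
Qed.

End orthonormal_bases.

Section traces.
Context {R : realType} (V : lmodType R) (dot : V -> V -> R).
Hypothesis Hd : hilbert_dot dot.

(** A positive operator is its own absolute value, so [T] serves as the witness [S]; its diagonal is
    nonnegative, so the negative part in the trace vanishes. *)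
Lemma is_trace_positive T t : positive_operator dot T ->
  (forall B, orthonormal_basis dot B ->
     (\esum_(e in B) (dot (T e) e)%:E = t%:E)%E) ->
  is_trace dot T t.
Proof.
move=> posT trT; have [bT symT geT] := posT; split.
  split => //; exists T; split => //;
    have [B bB] := exists_orthonormal_basis Hd.
  by exists B => //; rewrite trT// ltry.
move=> B bB u.
rewrite -(trT B bB) -[RHS]sube0; congr (_ - _)%E.
  by apply: eq_esum => e _; rewrite funeposE; apply/max_idPl; rewrite lee_fin.
by apply: esum1 => e _; rewrite funenegE; apply/max_idPr;
  rewrite oppe_le0 lee_fin.
Qed.

End traces.

(** * Covariance operators *)

Section covariance_operator.
Context {R : realType} (V : lmodType R) (dot : V -> V -> R).
Hypothesis Hd : hilbert_dot dot.
Variable q : nat -> V.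
Hypothesis sep : forall x, (forall n, dot x (q n) = 0) -> x = 0.
Context {d} {X : measurableType d} (P : probability X R) (xi : X -> V).
Hypothesis mxi : forall f, measurable_fun [set: X] (fun x => dot f (xi x)).
Hypothesis ixi : P.-integrable [set: X] (fun x => (dot (xi x) (xi x))%:E).

Let K := \int[P]_x dot (xi x) (xi x).

Let form_le f g x :
  `|dot f (xi x) * dot g (xi x)| <=
  Num.sqrt (dot f f * dot g g) * dot (xi x) (xi x).
Proof.
rewrite normrM sqrtrM ?(hdot_ge0 Hd)//.
apply: le_trans (ler_pM (normr_ge0 _) (normr_ge0 _)
  (hdot_CauchySchwarz_norm Hd _ _) (hdot_CauchySchwarz_norm Hd _ _)) _.
by rewrite mulrACA -(expr2 (Num.sqrt (dot (xi x) _))) sqr_sqrtr ?(hdot_ge0 Hd).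
Qed.

Let integrable_form f g :
  P.-integrable [set: X] (EFin \o (fun x => dot f (xi x) * dot g (xi x))).
Proof.
apply: (le_integrable measurableT _ _
  (integrableZl measurableT (Num.sqrt (dot f f * dot g g)) ixi)).
  by apply/measurable_EFinP; apply: measurable_funM.
by move=> x _ /=; rewrite lee_fin (le_trans (form_le f g x))// ler_norm.
Qed.

Let B f g := \int[P]_x (dot f (xi x) * dot g (xi x)).

Let BC f g : B f g = B g f.
Proof. by apply: eq_Rintegral => x _; rewrite mulrC. Qed.

Let BP a f f' g : B (a *: f + f') g = a * B f g + B f' g.
Proof.
rewrite /B -RintegralZl// -RintegralD//; last first.
  exact: (integrableZl measurableT a (integrable_form f g)).
by apply: eq_Rintegral => x _; rewrite (hdotP Hd) mulrDl mulrA.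
Qed.

Let K_ge0 : 0 <= K.
Proof. by apply: Rintegral_ge0 => x _; exact: hdot_ge0. Qed.

Let B_bound f g : B f g ^+ 2 <= (K ^+ 2 * dot g g) * dot f f.
Proof.
have h : `|B f g| <= Num.sqrt (dot f f * dot g g) * K.
  apply: (le_trans (le_normr_Rintegral _ _ )) => //.
  rewrite -RintegralZl//; apply: le_Rintegral => //.
  - exact: (integrable_norm (integrable_form f g)).
  - exact: (integrableZl measurableT _ ixi).
have : `|B f g| ^+ 2 <= (Num.sqrt (dot f f * dot g g) * K) ^+ 2.
  by rewrite ler_pXn2r// nnegrE ?mulr_ge0 ?sqrtr_ge0.
rewrite real_normK ?num_real// exprMn sqr_sqrtr ?mulr_ge0 ?(hdot_ge0 Hd)//.
by move/le_trans; apply; rewrite le_eqVlt; apply/orP; left; apply/eqP; ring.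
Qed.

Let basis_enum A : orthonormal_basis dot A -> exists e : nat -> V,
  [/\ orthonormal_seq dot e, forall x, (forall n, dot x (e n) = 0) -> x = 0 &
    forall a : V -> \bar R, (forall x, (0 <= a x)%E) -> a 0 = 0%E ->
      (\esum_(x in A) a x = \sum_(n <oo) a (e n))%E].
Proof.
move=> bA; apply: (orthonormal_basis_enum Hd _ bA).
exact: (orthonormal_basis_countable Hd sep bA).
Qed.

(** For each [g] the functional [B ^~ g] is bounded, by Cauchy-Schwarz under the integral; Riesz
    represents it and choice collects the representers into [C]. *)
Lemma covariance_operator_exists :
  exists C : V -> V, forall f g, dot f (C g) = \int[P]_x (dot f (xi x) * dot g
    (xi x)).
Proof.
have [A bA] := exists_orthonormal_basis Hd.
have [e [one te _]] := basis_enum bA.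
have [C hC] : {C : V -> V & forall g f, B f g = dot f (C g)}.
  apply: (@choice _ _ (fun g w => forall f, B f g = dot f w)) => g.
  apply: (riesz Hd one te (M := K ^+ 2 * dot g g)).
  - by rewrite mulr_ge0 ?sqr_ge0 ?(hdot_ge0 Hd).
  - by move=> a f f'; exact: BP.
  - by move=> f; exact: B_bound.
by exists C => f g; rewrite -hC.
Qed.

Section properties.
Variable C : V -> V.
Hypothesis CE : forall f g, dot f (C g) = \int[P]_x (dot f (xi x) * dot g (xi
  x)).

(** Testing [B_bound] with [f = C g] bounds the square of [dot (C g) (C g)] by a multiple of itself,
    and one factor cancels. *)
Let C_bound g : dot (C g) (C g) <= K ^+ 2 * dot g g.
Proof.
have [->|Cg0] := eqVneq (dot (C g) (C g)) 0.
  by rewrite mulr_ge0 ?sqr_ge0 ?(hdot_ge0 Hd).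
have := B_bound (C g) g; rewrite /B -CE expr2 ler_pM2r//.
by rewrite lt_neqAle eq_sym Cg0 (hdot_ge0 Hd).
Qed.

Let C_linear : linear C.
Proof.
move=> a x y; apply: (hdot_ext Hd) => z.
rewrite (hdotDr Hd) (hdotZr Hd) !CE -!/(B _ _).
by rewrite BC BP [B x z]BC [B y z]BC.
Qed.

Let C_bounded : bounded_operator dot C.
Proof. by split => //; exists (K ^+ 2); exact: C_bound. Qed.

Let C_sym x y : dot (C x) y = dot x (C y).
Proof. by rewrite (hdotC Hd) !CE -!/(B _ _) BC. Qed.

Let C_positive : positive_operator dot C.
Proof.
split => // x; rewrite C_sym CE; apply: Rintegral_ge0 => y _.
exact: sqr_ge0.
Qed.

Let C0 : C 0 = 0.
Proof. by apply: (hdot_ext Hd) => z; rewrite -C_sym !(hdot0r Hd). Qed.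

Lemma covariance_operator_expectation :
  is_operator_expectation dot P (fun x => tensor dot (xi x) (xi x)) C.
Proof.
split => // f g.
have E x : dot f (tensor dot (xi x) (xi x) g) = dot f (xi x) * dot g (xi x).
  by rewrite /tensor (hdotZr Hd) mulrC (hdotC Hd (xi x)).
split.
  by under [X in _.-integrable _ X]eq_fun do rewrite E; exact: integrable_form.
rewrite expectation.unlock CE /Rintegral fineK; last first.
  by apply: integrable_fin_num => //; exact: integrable_form.
by apply: eq_integral => x _; rewrite E.
Qed.

Lemma covariance_operator_unique C' :
  is_operator_expectation dot P (fun x => tensor dot (xi x) (xi x)) C' -> C' =
    C.
Proof.
move=> [_ C'E]; have [_ CE'] := covariance_operator_expectation.
apply/funext => g; apply: (hdot_ext Hd) => f; apply: EFin_inj.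
by rewrite -(C'E f g).2 -(CE' f g).2.
Qed.

Lemma trace_covariance_operator t :
  (\int[P]_x (dot (xi x) (xi x))%:E = t%:E)%E -> is_trace dot C t.
Proof.
move=> tE; apply: (is_trace_positive Hd C_positive) => A bA.
have [e [one te ->]] := basis_enum bA; last 2 first.
- by move=> x; rewrite lee_fin; have [_ _] := C_positive; apply.
- by rewrite C0 (hdot0l Hd).
transitivity (\sum_(n <oo) \int[P]_x (dot (e n) (xi x) ^+ 2)%:E)%E.
  apply: eq_eseriesr => n _; rewrite C_sym CE /Rintegral fineK//.
  by apply: integrable_fin_num => //; exact: integrable_form.
(* The terms are squares, so sum and expectation commute by monotone convergence; Parseval then sums
   the integrand. *)
rewrite -integral_nneseries//; last 2 first.
- by move=> n; apply/measurable_EFinP; exact: measurable_funX.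
- by move=> n x _; rewrite lee_fin sqr_ge0.
rewrite -tE; apply: eq_integral => x _.
apply/cvg_lim => //.
under eq_fun do rewrite sumEFin.
apply/cvg_EFin; first exact: nearW.
have := parseval Hd one te (x := xi x) (y := xi x).
apply: cvg_trans; apply: near_eq_cvg; apply: nearW => n /=.
by rewrite big_mkord; apply: eq_bigr => i _; rewrite (hdotC Hd) expr2.
Qed.

Lemma trace_covariance_operator_sqr t :
  (\int[P]_x \int[P]_y (dot (xi x) (xi y) ^+ 2)%:E = t%:E)%E ->
  is_trace dot (C \o C) t.
Proof.
move=> tE.
have posCC : positive_operator dot (C \o C).
  split => [|x y|x] /=; last 2 first.
  - by rewrite !C_sym.
  - by rewrite C_sym (hdot_ge0 Hd).
  split; first by move=> a x y /=; rewrite !C_linear.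
  exists (K ^+ 2 * K ^+ 2) => x; apply: (le_trans (C_bound _)).
  by rewrite -[leRHS]mulrA; apply: ler_wpM2l; [exact: sqr_ge0|exact: C_bound].
apply: (is_trace_positive Hd posCC) => A bA.
have [e [one te ->]] := basis_enum bA; last 2 first.
- by move=> x; rewrite lee_fin; have [_ _] := posCC; apply.
- by rewrite (hdot0r Hd).
(* Partial Parseval sums for [dot (xi x) (C (xi x))]. Their terms may change sign, hence dominated
   rather than monotone convergence below. *)
pose F n x := \sum_(i < n) dot (xi x) (e i) * dot (C (xi x)) (e i).
have mF n : measurable_fun [set: X] (F n).
  apply: measurable_sum => i; apply: measurable_funM.
    by under eq_fun do rewrite (hdotC Hd); exact: mxi.
  by under eq_fun do rewrite C_sym (hdotC Hd); exact: mxi.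
have FE n : (\int[P]_x (F n x)%:E = (\sum_(i < n) dot (C (C (e i))) (e
  i))%:E)%E.
  rewrite -sumEFin; under eq_integral do rewrite /F -sumEFin.
  (* Symmetry moves [C] onto the fixed vector [e i], which turns the term into the form defining
     [C], evaluated at [C (e i)] and [e i]. *)
  have E i : (fun x => (dot (xi x) (e i) * dot (C (xi x)) (e i))%:E) =
      (fun x => (dot (C (e i)) (xi x) * dot (e i) (xi x))%:E).
    apply/funext => x; congr EFin; rewrite mulrC C_sym (hdotC Hd (xi x) (C _)).
    by rewrite (hdotC Hd (xi x)).
  rewrite integral_sum//; last by move=> i; rewrite E; exact: integrable_form.
  apply: eq_bigr => i _; rewrite E C_sym CE /Rintegral fineK//.
  by apply: integrable_fin_num => //; exact: integrable_form.
have Fcvg x : F n x @[n --> \oo] --> dot (xi x) (C (xi x)).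
  exact: (parseval Hd one te).
have mlim : measurable_fun [set: X] (fun x => dot (xi x) (C (xi x))).
  by apply: (measurable_fun_cvg mF) => x _; exact: Fcvg.
(* Each product is at most the sum of the two squares; Bessel for [xi x] gives the [1], Bessel for
   [C (xi x)] followed by [C_bound] gives the [K ^+ 2]. *)
have F_le n x : `|F n x| <= (1 + K ^+ 2) * dot (xi x) (xi x).
  apply: (@le_trans _ _ (\sum_(i < n) (dot (xi x) (e i) ^+ 2 + dot (C (xi x))
    (e i) ^+ 2))).
    apply: (le_trans (ler_norm_sum _ _ _)); apply: ler_sum => i _.
    rewrite ler_norml; apply/andP; split.
      have := sqr_ge0 (dot (xi x) (e i) + dot (C (xi x)) (e i)).
      have := sqr_ge0 (dot (xi x) (e i));
        have := sqr_ge0 (dot (C (xi x)) (e i)).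
      nra.
    have := sqr_ge0 (dot (xi x) (e i) - dot (C (xi x)) (e i)).
    have := sqr_ge0 (dot (xi x) (e i)); have := sqr_ge0 (dot (C (xi x)) (e i)).
    nra.
  rewrite big_split/= mulrDl mul1r lerD//; first exact: (bessel Hd one).
  exact: (le_trans (bessel Hd one _ _) (C_bound _)).
have cvgF : (\int[P]_x (F n x)%:E)%E @[n --> \oo] -->
    (\int[P]_x (dot (xi x) (C (xi x)))%:E)%E.
  apply: (dominated_cvg (mu := P) measurableT
    (g := fun x => ((1 + K ^+ 2)%:E * (dot (xi x) (xi x))%:E)%E)).
  - by move=> n; apply/measurable_EFinP.
  - by move=> x _; apply: cvg_EFin; [exact: nearW|exact: Fcvg].
  - by [].
  - exact: (integrableZl measurableT _ ixi).
  - by move=> n x _; rewrite lee_fin; exact: F_le.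
transitivity (\int[P]_x (dot (xi x) (C (xi x)))%:E)%E; last first.
  rewrite -tE; apply: eq_integral => x _; rewrite CE /Rintegral fineK//.
  by apply: integrable_fin_num => //; exact: integrable_form.
apply/cvg_lim => //; apply: cvg_trans cvgF; apply: near_eq_cvg;
  apply: nearW => n.
by rewrite /= FE sumEFin big_mkord.
Qed.

End properties.

End covariance_operator.

(** * Gaussian integrals *)

Section has_integral.
Context d (T : measurableType d) (R : realType) (mu : {measure set T -> \bar
  R}).
Implicit Types (f g : T -> R).

(** Integrability and a finite value travel together, so that linear combinations of known integrals
    carry no side conditions. *)
Definition has_integral f (v : R) :=
  mu.-integrable [set: T] (EFin \o f) /\ (\int[mu]_x (f x)%:E = v%:E)%E.

Lemma eq_has_integral f g u v :
  f =1 g -> u = v -> has_integral f u -> has_integral g v.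
Proof. by move=> /funext -> ->. Qed.

Lemma has_integralD f g u v :
  has_integral f u -> has_integral g v -> has_integral (fun x => f x + g x) (u
    + v).
Proof.
move=> [fi fu] [gi gv]; split; first exact: (integrableD measurableT fi gi).
by under eq_integral do rewrite EFinD; rewrite integralD// fu gv.
Qed.

Lemma has_integralZ f a u :
  has_integral f u -> has_integral (fun x => a * f x) (a * u).
Proof.
move=> [fi fu]; split; first exact: (integrableZl measurableT a fi).
by under eq_integral do rewrite EFinM; rewrite integralZl// fu.
Qed.

Lemma has_integral_sum I (r : seq I) (F : I -> T -> R) (v : I -> R) :
  (forall i, has_integral (F i) (v i)) ->
  has_integral (fun x => \sum_(i <- r) F i x) (\sum_(i <- r) v i).
Proof.
move=> Fv; elim: r => [|i r IH].
  split; first by under eq_fun do rewrite big_nil; exact: integrable0.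
  by under eq_integral do rewrite big_nil; rewrite integral0 big_nil.
rewrite big_cons; under eq_fun do rewrite big_cons.
exact: has_integralD.
Qed.

End has_integral.

(** * Integration against a normal law through its density *)

Section normal_moments.
Context {R : realType}.
Local Notation mu := (@lebesgue_measure R).

(** Change of variables is available for the Radon-Nikodym derivative; it agrees almost everywhere
    with [normal_pdf], since both have the same integral over every measurable set. *)
Lemma ge0_integral_normal_prob (m s : R) (f : R -> \bar R) :
  (forall x, (0 <= f x)%E) -> measurable_fun [set: R] f ->
  (\int[normal_prob m s]_x f x = \int[mu]_x (f x * (normal_pdf m s x)%:E))%E.
Proof.
move=> f0 mf; have dom := normal_prob_dominates m s.
rewrite -(Radon_Nikodym_SigmaFinite.change_of_variables dom f0 measurableT mf).
have fi := Radon_Nikodym_SigmaFinite.f_integrable dom.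
apply: ge0_ae_eq_integral => //.
- by apply: emeasurable_funM => //; exact: (measurable_int _ fi).
- apply: emeasurable_funM => //; apply/measurable_EFinP.
  exact: measurable_normal_pdf.
- by move=> x _; rewrite mule_ge0//; exact: Radon_Nikodym_SigmaFinite.f_ge0.
- by move=> x _; rewrite mule_ge0// lee_fin normal_pdf_ge0.
apply: ae_eqe_mul2l; apply: integral_ae_eq => //.
  by apply/measurable_EFinP; exact: measurable_normal_pdf.
by move=> E _ mE; rewrite -Radon_Nikodym_SigmaFinite.f_integral.
Qed.

(** The density is nonnegative, so it factors out of the positive part, the negative part and the
    absolute value, reducing to the nonnegative case. *)
Lemma has_integral_normal_prob (m s : R) (f : R -> R) v :
  measurable_fun [set: R] f ->
  has_integral (normal_prob m s) f v <->
  has_integral mu (fun x => f x * normal_pdf m s x) v.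
Proof.
move=> mf.
have mfp : measurable_fun [set: R] (EFin \o (fun x => f x * normal_pdf m s x)).
  apply/measurable_EFinP; apply: measurable_funM => //.
  exact: measurable_normal_pdf.
have mEf : measurable_fun [set: R] (EFin \o f) by apply/measurable_EFinP.
have posE : ((EFin \o (fun x => (f x * normal_pdf m s x)%R))^\+)%E =
    (fun x => (EFin \o f)^\+ x * (normal_pdf m s x)%:E)%E.
  apply/funext => x; rewrite !funeposE /= -EFin_max -EFin_max -EFinM.
  by rewrite maxr_pMl ?normal_pdf_ge0// mul0r.
have negE : ((EFin \o (fun x => (f x * normal_pdf m s x)%R))^\-)%E =
    (fun x => (EFin \o f)^\- x * (normal_pdf m s x)%:E)%E.
  apply/funext => x; rewrite !funenegE /= -EFin_max -EFin_max -EFinM.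
  by rewrite maxr_pMl ?normal_pdf_ge0// mul0r mulNr.
have intE : (\int[normal_prob m s]_x (f x)%:E =
    \int[mu]_x (f x * normal_pdf m s x)%:E)%E.
  rewrite integralE [RHS]integralE; congr (_ - _)%E.
    by rewrite posE ge0_integral_normal_prob//; exact: measurable_funepos.
  by rewrite negE ge0_integral_normal_prob//; exact: measurable_funeneg.
have absE : (\int[normal_prob m s]_x `|(f x)%:E| =
    \int[mu]_x `|(f x * normal_pdf m s x)%:E|)%E.
  rewrite ge0_integral_normal_prob//; last exact: measurableT_comp.
  by apply: eq_integral => x _; rewrite EFinM abseM; congr (_ * _)%E;
    rewrite gee0_abs// lee_fin normal_pdf_ge0.
rewrite /has_integral intE; split=> -[/integrableP[_ h] ->]; split => //;
  apply/integrableP; split => //.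
  by rewrite -absE.
by rewrite absE.
Qed.

End normal_moments.

(** * Integrability and recursion for central moments *)

Section normal_central_moments.
Context {R : realType} (m s : R).
Hypothesis s0 : s != 0.
Local Notation mu := (@lebesgue_measure R).
Local Notation pdf := (normal_pdf m s).

Lemma is_derive_normal_pdf (x : R) :
  is_derive x 1 pdf (- (x - m) / s ^+ 2 * pdf x).
Proof.
rewrite normal_pdfE//.
have h : is_derive x (1 : R) (fun x : R => - (x - m) ^+ 2 / (s ^+ 2 *+ 2) : R)
    (- (x - m) / s ^+ 2).
  by apply: is_derive_eq; rewrite /GRing.scale/=; field.
have h2 : is_derive x 1 (normal_fun m s) (- (x - m) / s ^+ 2 * normal_fun m s
  x).
  apply: is_derive_eq; rewrite /normal_fun mulrC //.
apply: is_derive_eq; rewrite /GRing.scale/=; ring.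
Qed.

Lemma is_derive_central_power k (x : R) :
  is_derive x 1 (fun x => (x - m) ^+ k * pdf x)
    (k%:R * (x - m) ^+ k.-1 * pdf x - (x - m) ^+ k.+1 / s ^+ 2 * pdf x).
Proof.
have hp := is_derive_normal_pdf x.
have h1 : is_derive x (1 : R) (fun x : R => x - m) 1.
  by apply: is_derive_eq; rewrite subr0.
have -> : (fun x => (x - m) ^+ k * pdf x) = ((fun x : R => x - m) ^+ k * pdf).
  by apply/funext => y; rewrite [in RHS]/GRing.mul/= exprfctE.
apply: (is_derive_eq (is_deriveM (is_deriveX k h1) hp)).
by rewrite /GRing.scale/= exprfctE [_ ^+ k.+1]exprS; field.
Qed.

Lemma continuous_central_power k : continuous (fun x : R => (x - m) ^+ k * pdf
  x).
Proof.
move=> x; apply: differentiable_continuous; apply/derivable1_diffP.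
exact: (@ex_derive _ _ _ _ _ _ _ (is_derive_central_power k x)).
Qed.

(** With [y = (x - m) ^+ 2 / (4 * s ^+ 2)], the Gaussian is [expR (- y)] squared: one factor is the
    shape of a normal law of variance [2 * s ^+ 2], the other absorbs the power. The constant comes
    from [|w| ^+ k <= 1 + w ^+ 4], [w ^+ 4 = 16 * s ^+ 4 * y ^+ 2] and [y ^+ 2 <= 2 * expR y]. *)
Lemma central_power_le k x : (k <= 4)%N ->
  `|(x - m) ^+ k * pdf x| <=
  (1 + 32 * s ^+ 4) * normal_peak s / normal_peak (Num.sqrt 2 * s) *
    normal_pdf m (Num.sqrt 2 * s) x.
Proof.
move=> k4; have t0 : Num.sqrt 2 * s != 0.
  by rewrite mulf_neq0// gt_eqF// sqrtr_gt0.
rewrite normal_pdfE// normal_pdfE//.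
set p := normal_peak _; set p' := normal_peak _.
have p'0 : p' != 0 by rewrite gt_eqF// normal_peak_gt0.
set w := x - m; pose y := w ^+ 2 / (4 * s ^+ 2).
have y0 : 0 <= y by rewrite divr_ge0 ?sqr_ge0// mulr_ge0 ?sqr_ge0.
have -> : normal_fun m s x = expR (- y) * expR (- y).
  by rewrite -expRD /normal_fun -/w; congr expR; rewrite /y; field.
have -> : normal_fun m (Num.sqrt 2 * s) x = expR (- y).
  rewrite /normal_fun -/w exprMn sqr_sqrtr//; congr expR; rewrite /y; field.
  done.
have h : `|w| ^+ k <= (1 + 32 * s ^+ 4) * expR y.
  apply: (@le_trans _ _ (1 + w ^+ 4)).
    have [w1|w1] := leP `|w| 1.
      by rewrite (le_trans (exprn_ile1 _ _ _))// lerDl exprn_even_ge0.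
    rewrite (le_trans (ler_weXn2l (ltW w1) k4))// -normrX ger0_norm
      ?exprn_even_ge0//.
    by rewrite lerDr.
  have e2 := expR_ge1Dxn 1 y0; have e4 : w ^+ 4 = 16 * s ^+ 4 * y ^+ 2.
    by rewrite /y; field.
  have s4 : 0 <= s ^+ 4 by rewrite exprn_even_ge0.
  rewrite e4 (_ : _ * expR y = expR y + 16 * s ^+ 4 * (2 * expR y));
    last by ring.
  apply: lerD; first by rewrite (le_trans _ e2)// lerDl divr_ge0 ?sqr_ge0.
  apply: ler_wpM2l; first by rewrite pmulr_rge0.
  rewrite mulrC -ler_pdivrMr//.
  by rewrite (le_trans _ e2)// lerDr.
have -> : (1 + 32 * s ^+ 4) * p / p' * (p' * expR (- y)) =
    p * (expR (- y) * expR (- y) * ((1 + 32 * s ^+ 4) * expR y)).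
  have ey : expR (- y) * expR y = 1 by rewrite -expRD addNr expR0.
  transitivity (p * expR (- y) * (1 + 32 * s ^+ 4) * (expR (- y) * expR y)).
    by rewrite ey; field.
  by ring.
have p0 : 0 <= p by exact: normal_peak_ge0.
rewrite mulrCA normrM (ger0_norm p0); apply: ler_wpM2l => //.
have ee0 : 0 <= expR (- y) * expR (- y) by rewrite mulr_ge0 ?expR_ge0.
by rewrite normrM normrX [leLHS]mulrC (ger0_norm ee0); apply: ler_wpM2l.
Qed.

Lemma integrable_central_power k : (k <= 4)%N ->
  mu.-integrable [set: R] (EFin \o (fun x => (x - m) ^+ k * pdf x)).
Proof.
move=> k4; have t0 : Num.sqrt 2 * s != 0.
  by rewrite mulf_neq0// gt_eqF// sqrtr_gt0.
apply: (le_integrable measurableT _ _ (integrableZl measurableT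
  ((1 + 32 * s ^+ 4) * normal_peak s / normal_peak (Num.sqrt 2 * s))
  (integrable_normal_pdf m (Num.sqrt 2 * s)))).
  apply/measurable_EFinP; apply: measurable_funM;
    last exact: measurable_normal_pdf.
  by apply: measurable_funX; exact: measurable_funB.
move=> x _ /=; rewrite lee_fin (le_trans (central_power_le x k4))//.
by rewrite ler_norm.
Qed.

Lemma cvg_central_power k (a : R) : `|a| = 1 -> (k <= 3)%N ->
  (a * n.+1%:R) ^+ k * pdf (m + a * n.+1%:R) @[n --> \oo] --> (0 : R).
Proof.
move=> a1 k3; have t0 : Num.sqrt 2 * s != 0.
  by rewrite mulf_neq0// gt_eqF// sqrtr_gt0.
set C := (1 + 32 * s ^+ 4) * normal_peak s / normal_peak (Num.sqrt 2 * s) *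
  normal_peak (Num.sqrt 2 * s).
(* Multiplying by [n.+1%:R], the distance to the mean, raises the power to [k.+1 <= 4], which is
   still bounded; this gains the decay [n.+1%:R^-1]. *)
have bnd n : `|(a * n.+1%:R) ^+ k * pdf (m + a * n.+1%:R)| <= C * n.+1%:R^-1.
  rewrite ler_pdivlMr//.
  set z := m + a * n.+1%:R.
  have zm : z - m = a * n.+1%:R by rewrite /z addrAC subrr add0r.
  have -> : `|(a * n.+1%:R) ^+ k * pdf z| * n.+1%:R = `|(z - m) ^+ k.+1 * pdf
    z|.
    by rewrite zm exprSr !normrM a1 mul1r normr_nat mulrAC.
  rewrite (le_trans (central_power_le _ _))// ler_wpM2l//;
    last exact: normal_pdf_ub.
  rewrite divr_ge0 ?normal_peak_ge0// mulr_ge0 ?normal_peak_ge0//.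
  by rewrite addr_ge0// mulr_ge0// exprn_even_ge0.
apply/norm_cvg0P.
have h : C * n.+1%:R^-1 @[n --> \oo] --> (0 : R).
  by rewrite -[X in _ --> X](mulr0 C); apply: cvgMr; exact: cvg_harmonic.
apply: (squeeze_cvgr _ (cvg_cst 0) h).
by apply: nearW => n; rewrite normr_ge0 bnd.
Qed.

(** Integration by parts: the integrand is the derivative of [(x - m) ^+ k * pdf x], which vanishes
    at both infinities. *)
Lemma central_power_rec k : (k <= 3)%N ->
  has_integral mu (fun x : R => k%:R * ((x - m) ^+ k.-1 * pdf x)
    + (- (s ^+ 2)^-1) * ((x - m) ^+ k.+1 * pdf x)) 0.
Proof.
move=> k3; set f := fun x : R => _.
have fi : mu.-integrable [set: R] (EFin \o f).
  have k4 : (k.-1 <= 4)%N by rewrite (leq_trans (leq_pred _))// ltnW.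
  exact: (integrableD measurableT
    (integrableZl measurableT k%:R (integrable_central_power k4))
    (integrableZl measurableT (- (s ^+ 2)^-1) (@integrable_central_power k.+1
      k3))).
(* On intervals exhausting the line, the fundamental theorem gives boundary values tending to [0],
   while dominated convergence with bound [|f|] gives the full integral. *)
split => //; pose I n := `[m - n.+1%:R, m + n.+1%:R]%classic : set R.
pose F x := (x - m) ^+ k * pdf x.
have dF (x : R) : is_derive x 1 F (f x).
  by apply: (is_derive_eq (is_derive_central_power k x)); rewrite /f; ring.
have cf : continuous f.
  by move=> x; apply: cvgD; apply: cvgMr; exact: continuous_central_power.
have FTC n : (\int[mu]_(x in I n) (f x)%:E = (F (m + n.+1%:R) - F (m -
  n.+1%:R))%:E)%E.
  rewrite EFinB; apply: continuous_FTC2.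
  - by rewrite ltrD2l (@lt_trans _ _ 0) ?oppr_lt0 ?ltr0n.
  - exact: continuous_subspaceT.
  - have cF : continuous F by exact: continuous_central_power.
    split; first by move=> x _; exact: (@ex_derive _ _ _ _ _ _ _ (dF x)).
    - by apply: cvg_at_right_filter; exact: cF.
    - by apply: cvg_at_left_filter; exact: cF.
  - by move=> x _; rewrite derive1E; exact: (@derive_val _ _ _ _ _ _ _ (dF x)).
have lim0 : (\int[mu]_(x in I n) (f x)%:E)%E @[n --> \oo] --> 0%E.
  under eq_fun do rewrite FTC.
  apply: cvg_EFin; first exact: nearW.
  rewrite -[X in _ --> X](subr0 0); apply: cvgB.
    have := @cvg_central_power k 1 (normr1 _) k3; apply: cvg_trans.
    apply: near_eq_cvg; apply: nearW => n.
    by rewrite /F/= mul1r addrAC subrr add0r.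
  have := @cvg_central_power k (-1) (normrN1 _) k3; apply: cvg_trans.
  apply: near_eq_cvg; apply: nearW => n.
  by rewrite /F/= mulN1r addrAC subrr add0r.
apply: (cvg_unique _ _ lim0) => //.
change ((\int[mu]_(x in I n) (f x)%:E)%E @[n --> \oo] --> (\int[mu]_x (f
  x)%:E)%E).
under eq_fun do rewrite integral_mkcond.
apply: (dominated_cvg (mu := mu) measurableT (g := fun x => `|(f x)%:E|%E)) =>
  //.
- move=> n; apply/(measurable_restrictT _ _).1 => //.
    exact: measurable_itv.
  by apply: measurable_funTS; exact: measurable_int fi.
- move=> x _; apply: cvg_near_cst.
  exists (Num.trunc `|x - m|) => // n /= Nn.
  have xI : I n x.
    rewrite /I/= in_itv/= -ler_distl (le_trans (ltW (truncnS_gt _)))//.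
    by rewrite ler_nat ltnS.
  by rewrite patchE mem_set.
- exact: integrable_abse.
- move=> n x _; rewrite /patch; case: ifPn => // _; rewrite abse0//.
Qed.

End normal_central_moments.

(** * Quartic polynomials times Gaussian weights *)

Section tilted_normal.
Context {R : realType}.
Local Notation mu := (@lebesgue_measure R).

Lemma has_integral_central_power_step (m s : R) k a : s != 0 -> (k <= 3)%N ->
  has_integral mu (fun x : R => (x - m) ^+ k.-1 * normal_pdf m s x) a ->
  has_integral mu (fun x : R => (x - m) ^+ k.+1 * normal_pdf m s x)
    (k%:R * s ^+ 2 * a).
Proof.
move=> s0 k3 ha.
have := has_integralD (has_integralZ (k%:R * s ^+ 2) ha)
  (has_integralZ (- s ^+ 2) (central_power_rec m s0 k3)).
rewrite mulr0 addr0; congr has_integral; apply/funext => x; field.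
exact: s0.
Qed.

Lemma has_integral_quartic_normal_pdf (m s a0 a1 a2 a3 a4 : R) : s != 0 ->
  has_integral mu (fun x : R => (a0 + a1 * (x - m) + a2 * (x - m) ^+ 2 +
     a3 * (x - m) ^+ 3 + a4 * (x - m) ^+ 4) * normal_pdf m s x)
    (a0 + a2 * s ^+ 2 + a4 * (3 * s ^+ 4)).
Proof.
move=> s0.
have h0 : has_integral mu (fun x : R => (x - m) ^+ 0 * normal_pdf m s x) 1.
  under eq_fun do rewrite expr0 mul1r.
  by split; [exact: integrable_normal_pdf|exact: integral_normal_pdf].
(* With [k = 0] the predecessor [k.-1] is again [0] and the factor [k%:R] vanishes, which gives
   first moment [0]. *)
have h1 := @has_integral_central_power_step m s 0 1 s0 erefl h0.
have h2 := @has_integral_central_power_step m s 1 1 s0 erefl h0.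
have h3 := @has_integral_central_power_step m s 2 _ s0 erefl h1.
have h4 := @has_integral_central_power_step m s 3 _ s0 erefl h2.
have := has_integralD (has_integralZ a0 h0) (has_integralD (has_integralZ a1 h1)
  (has_integralD (has_integralZ a2 h2) (has_integralD (has_integralZ a3 h3)
    (has_integralZ a4 h4)))).
congr has_integral; last by ring.
by apply/funext => x; ring.
Qed.

(** The term [x ^+ 2 / 2] cancels the exponent of the standard normal density, leaving a Gaussian of
    mean [m] and variance [kappa^-1]; [Num.sqrt kappa^-1] is the ratio of the normalising
    constants. *)
Lemma has_integral_tilted_normal (kappa m L a0 a1 a2 a3 a4 : R) : 0 < kappa ->
  has_integral (normal_prob (0 : R) 1)
    (fun x => (a0 + a1 * (x - m) + a2 * (x - m) ^+ 2 +
     a3 * (x - m) ^+ 3 + a4 * (x - m) ^+ 4) *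
     expR (L + x ^+ 2 / 2 - kappa / 2 * (x - m) ^+ 2))
    (expR L * Num.sqrt kappa^-1 * (a0 + a2 / kappa + 3 * a4 / kappa ^+ 2)).
Proof.
move=> k0; apply/has_integral_normal_prob.
  apply: measurable_funM.
    by repeat first [apply: measurable_funD|apply: measurable_funM|
      apply: measurable_funX|apply: measurable_funB|exact: measurable_cst|
      exact: measurable_id].
  apply: measurableT_comp => //; apply: measurable_funB.
    by repeat first [apply: measurable_funD|apply: measurable_funM|
      apply: measurable_funX|exact: measurable_cst|exact: measurable_id].
  by repeat first [apply: measurable_funM|apply: measurable_funX|
      apply: measurable_funB|exact: measurable_cst|exact: measurable_id].
pose s := Num.sqrt kappa^-1.
have s2 : s ^+ 2 = kappa^-1 by rewrite sqr_sqrtr// invr_ge0 ltW.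
have sp : 0 < s by rewrite sqrtr_gt0 invr_gt0.
have s0 : s != 0 by rewrite gt_eqF.
have kn0 : kappa != 0 by rewrite gt_eqF.
apply: eq_has_integral
  (has_integralZ (expR L * s) (@has_integral_quartic_normal_pdf m s a0 a1 a2 a3
    a4 s0));
  last first.
  rewrite -/s (_ : s ^+ 4 = (s ^+ 2) ^+ 2); last by ring.
  by rewrite s2; field.
move=> x; rewrite normal_pdfE// normal_pdfE ?oner_eq0//.
have -> : normal_peak s = normal_peak 1 / s.
  rewrite /normal_peak -mulrnAr sqrtrM ?sqr_ge0// sqrtr_sqr gtr0_norm//.
  by rewrite expr1n mul1r invfM mulrC.
rewrite -[RHS]mulrA.
have -> : expR (L + x ^+ 2 / 2 - kappa / 2 * (x - m) ^+ 2) * (normal_peak 1 *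
  normal_fun 0 1 x)
    = normal_peak 1 * (expR L * normal_fun m s x).
  rewrite mulrCA -!expRD; congr (_ * expR _).
  rewrite s2; field.
  done.
by field.
Qed.

End tilted_normal.

(** * One-coordinate moments for a pair of independent standard normals *)

Section gaussian_pairs.
Context {R : realType}.
Variable gamma : R.
Hypothesis gamma0 : 0 < gamma.

(** The exponent carries [2 * gamma] because the kernel enters squared; [m] counts how many of the
    two summation indices select this coordinate. *)
Definition stein_factor (m : nat) (u v : R) : R :=
  (u * v - (2 * gamma + 4 * gamma ^+ 2) * (u - v) ^+ 2 + 2 * gamma) ^+ m *
  expR (- 2 * gamma * (u - v) ^+ 2).

Let N := normal_prob (0 : R) 1.
(** [T] is the precision in [v] for fixed [u], and [S / T] the precision then left in [u]. As a
    polynomial in [v] about the mean [4 * gamma / T * u], the base of the power in [stein_factor]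
    has value [alpha * u ^+ 2 + 2 * gamma], slope [beta * u] and quadratic coefficient [- c]; [Q m]
    is the mean of its [m]-th power under variance [T^-1]. [r1] and [r2] are the means of [Q 1] and
    [Q 2] in [u]. *)
Let S := 1 + 8 * gamma.
Let T := 1 + 4 * gamma.
Let c := 2 * gamma + 4 * gamma ^+ 2.
Let alpha := 4 * gamma / T - c / T ^+ 2.
Let beta := 1 + 2 * c / T.
Let Q (m : nat) (u : R) : R :=
  match m with
  | 0 => 1
  | 1 => alpha * u ^+ 2 + 2 * gamma - c / T
  | _ => (alpha * u ^+ 2 + 2 * gamma) ^+ 2 +
     ((beta * u) ^+ 2 - 2 * c * (alpha * u ^+ 2 + 2 * gamma)) / T +
     3 * c ^+ 2 / T ^+ 2
  end.
Let a (m : nat) (u : R) := expR (- (2 * gamma / T) * u ^+ 2) * Num.sqrt T^-1 *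
  Q m u.
Let r1 := 2 * gamma * (1 + 4 * gamma) / S.
Let r2 := r1 ^+ 2 +
  (128 * gamma ^+ 4 + 128 * gamma ^+ 3 + 80 * gamma ^+ 2 + 16 * gamma + 1) / S
    ^+ 2.

Let T0 : 0 < T. Proof. by rewrite /T addr_gt0// mulr_gt0. Qed.
Let S0 : 0 < S. Proof. by rewrite /S addr_gt0// mulr_gt0. Qed.

(* Completing the square: for fixed u the weight becomes, in v, a Gaussian
   of mean 4 gamma u / T and variance 1 / T. *)
Lemma stein_factor_inner (m : nat) u : (m <= 2)%N ->
  has_integral N (stein_factor m u) (a m u).
Proof.
have Tn0 : T != 0 by rewrite gt_eqF.
have Tn0' : 1 + 4 * gamma != 0 by [].
pose mean := 4 * gamma / T * u.
pose L := - (2 * gamma / T) * u ^+ 2.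
have expE v : - 2 * gamma * (u - v) ^+ 2 = L + v ^+ 2 / 2 - T / 2 * (v - mean)
  ^+ 2.
  by rewrite /L /mean /T; field.
pose A := alpha * u ^+ 2 + 2 * gamma.
pose B := beta * u.
have polyE v : u * v - (2 * gamma + 4 * gamma ^+ 2) * (u - v) ^+ 2 + 2 * gamma =
   A + B * (v - mean) - c * (v - mean) ^+ 2.
  by rewrite /A /B /mean /alpha /beta /c /T; field.
case: m => [|[|[|//]]] _.
- apply: eq_has_integral
    (@has_integral_tilted_normal R T mean L 1 0 0 0 0 T0) => [v|].
    by rewrite /stein_factor expE expr0; ring.
  by rewrite /a /Q -/L; ring.
- apply: eq_has_integral
    (@has_integral_tilted_normal R T mean L A B (- c) 0 0 T0) => [v|].
    by rewrite /stein_factor expE polyE expr1; ring.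
  by rewrite /a /Q -/L -/A; field.
- apply: eq_has_integral
    (@has_integral_tilted_normal R T mean L (A ^+ 2) (2 * A * B)
      (B ^+ 2 - 2 * A * c) (- 2 * B * c) (c ^+ 2) T0) => [v|].
    by rewrite /stein_factor expE polyE; ring.
  by rewrite /a /Q -/L -/A -/B; field.
Qed.

(** The weight left in [u] makes the standard normal a centred Gaussian of precision
    [1 + 4 * gamma / T = S / T], and the two normalising factors multiply to [Num.sqrt S^-1]. *)
Lemma stein_factor_outer (m : nat) : (m <= 2)%N ->
  has_integral N (a m) (Num.sqrt S^-1 *
    match m with 0 => 1 | 1 => r1 | _ => r2 end).
Proof.
have Tn0 : T != 0 by rewrite gt_eqF.
have Sn0 : S != 0 by rewrite gt_eqF.
have Tn0' : 1 + 4 * gamma != 0 by [].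
have Sn0' : 1 + 8 * gamma != 0 by [].
have k0 : 0 < S / T by rewrite divr_gt0.
have kT : Num.sqrt (S / T)^-1 * Num.sqrt T^-1 = Num.sqrt S^-1.
  rewrite -sqrtrM ?invr_ge0 ?(ltW k0)//; congr Num.sqrt.
  by rewrite /S /T; field; apply/andP.
have expE (v : R) : - (2 * gamma / T) * v ^+ 2 =
    0 + v ^+ 2 / 2 - (S / T) / 2 * (v - 0) ^+ 2.
  by rewrite /S /T; field.
case: m => [|[|[|//]]] _.
- apply: eq_has_integral (has_integralZ (Num.sqrt T^-1)
    (@has_integral_tilted_normal R (S / T) 0 0 1 0 0 0 0 k0)) => [v|].
    by rewrite /a expE /Q; ring.
  by rewrite expR0 -kT; ring.
- apply: eq_has_integral (has_integralZ (Num.sqrt T^-1)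
    (@has_integral_tilted_normal R (S / T) 0 0 (2 * gamma - c / T) 0 alpha 0 0
      k0)) => [v|].
    by rewrite /a expE /Q; ring.
  rewrite expR0 -kT (_ : r1 = 2 * gamma - c / T + alpha / (S / T));
    first by ring.
  by rewrite /r1 /alpha /c /S /T; field; apply/andP.
- apply: eq_has_integral (has_integralZ (Num.sqrt T^-1)
    (@has_integral_tilted_normal R (S / T) 0 0
      (4 * gamma ^+ 2 - 4 * c * gamma / T + 3 * c ^+ 2 / T ^+ 2) 0
      (4 * gamma * alpha + beta ^+ 2 / T - 2 * c * alpha / T) 0 (alpha ^+ 2)
        k0)) => [v|].
    by rewrite /a expE /Q; ring.
  rewrite expR0 -kT (_ : r2 = 4 * gamma ^+ 2 - 4 * c * gamma / T + 3 * c ^+ 2 /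
    T ^+ 2 +
    (4 * gamma * alpha + beta ^+ 2 / T - 2 * c * alpha / T) / (S / T) +
    3 * alpha ^+ 2 / (S / T) ^+ 2); first by ring.
  by rewrite /r2 /r1 /alpha /beta /c /S /T; field; apply/andP.
Qed.

Lemma stein_factor_moments : exists b : nat -> R -> R,
  (forall m u, (m <= 2)%N -> has_integral N (stein_factor m u) (b m u)) /\
  (forall m, (m <= 2)%N -> has_integral N (b m) (Num.sqrt S^-1 *
    match m with 0 => 1 | 1 => r1 | _ => r2 end)).
Proof.
by exists a; split; [exact: stein_factor_inner|exact: stein_factor_outer].
Qed.

End gaussian_pairs.

(** * Integrals of products over the coordinates of the Gaussian vector *)

Section product_integrals.
Context {R : realType}.

Lemma has_integral_measurable d (T : measurableType d)
    (mu : {measure set T -> \bar R}) (f : T -> R) v :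
  has_integral mu f v -> measurable_fun [set: T] f.
Proof. by move=> [/measurable_int/measurable_EFinP]. Qed.

Lemma has_integral_product d1 d2 (T1 : measurableType d1) (T2 : measurableType
  d2)
    (P1 : probability T1 R) (P2 : probability T2 R) (f : T1 -> R) (g : T2 -> R)
      u v :
  has_integral P1 f u -> has_integral P2 g v ->
  has_integral (P1 \x P2)%E (fun z => f z.1 * g z.2) (u * v).
Proof.
move=> hf hg; have mf := has_integral_measurable hf.
have mg := has_integral_measurable hg.
have [/integrableP[_ fi] fu] := hf; have [gint gv] := hg.
have /integrableP[_ gi] := gint.
have [fint _] := hf.
have mfg : measurable_fun setT (EFin \o (fun z : T1 * T2 => f z.1 * g z.2)).
  apply/measurable_EFinP; apply: measurable_funM.
    exact: (measurableT_comp mf measurable_fst).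
  exact: (measurableT_comp mg measurable_snd).
have ifg : (P1 \x P2)%E.-integrable setT (EFin \o (fun z : T1 * T2 => f z.1 * g
  z.2)).
  apply/integrable12ltyP => //=.
  have E x : (\int[P2]_y `|(f x * g y)%:E| = `|(f x)%:E| * \int[P2]_y `|(g
    y)%:E|)%E.
    rewrite -ge0_integralZl//;
      last exact: measurableT_comp (measurableT_comp _ mg).
    by apply: eq_integral => y _; rewrite EFinM abseM.
  under eq_integral do rewrite E.
  rewrite ge0_integralZr//; last 2 first.
  - exact: measurableT_comp (measurableT_comp _ mf).
  - exact: integral_ge0.
  by apply: lte_mul_pinfty => //;
    [exact: integral_ge0|rewrite ge0_fin_numE// integral_ge0].
split => //.
rewrite -(integral12_prod_meas1 ifg).
have E x : (\int[P2]_y (f x * g y)%:E = v%:E * (f x)%:E)%E.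
  rewrite muleC -gv -integralZl//.
rewrite /fubini_F/=; under eq_integral do rewrite E.
by rewrite integralZl// fu -EFinM mulrC.
Qed.

Lemma has_integral_distribution d d' (T : measurableType d) (T' :
  measurableType d')
    (P : probability T R) (X : {RV P >-> T'}) (f : T' -> R) v :
  measurable_fun [set: T'] f ->
  has_integral P (f \o X) v -> has_integral (distribution P X) f v.
Proof.
move=> mf [fi fv]; have mEf : measurable_fun [set: T'] (EFin \o f) by
  apply/measurable_EFinP.
split; last by rewrite integral_distribution.
exact: integrable_pushforward.
Qed.

Lemma has_integral_std_gaussian_prod n (g : 'I_n -> R -> R) (v : 'I_n -> R) :
  (forall i, has_integral (normal_prob (0 : R) 1) (g i) (v i)) ->
  has_integral (std_gaussian n) (fun x : 'rV[R]_n => \prod_i g i (x ord0 i))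
    (\prod_i v i).
Proof.
elim: n g v => [|n IH] g v gv /=.
  rewrite big_ord0; under eq_fun do rewrite big_ord0.
  have P1 := probability_setT (@std_gaussian R 0).
  split; last by rewrite integral_cst// mul1e.
  exact: (finite_measure_integrable_cst (std_gaussian 0) 1).
apply: has_integral_distribution.
  apply: measurable_prod => i _.
  exact: (measurableT_comp (has_integral_measurable (gv i)) (measurable_coord
    i)).
rewrite big_ord_recl.
have := has_integral_product (gv ord0)
  (IH (fun i => g (lift ord0 i)) (fun i => v (lift ord0 i)) (fun i => gv _)).
apply: eq_has_integral => // -[t x] /=.
rewrite big_ord_recl /row_cons mxE unlift_none; congr (_ * _).
by apply: eq_bigr => i _; rewrite mxE liftK.
Qed.

End product_integrals.

(** * Expected squared norm and expected squared Stein kernel *)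

Section stein_kernel_moments.
Context {R : realType} (n : nat).
Variable gamma : R.
Hypothesis gamma0 : 0 < gamma.

Lemma has_integral_std_gaussian_sqnorm (a : R) :
  has_integral (std_gaussian n) (fun x : 'rV[R]_n => \sum_i (x ord0 i ^+ 2 + a))
    ((1 + a) * n%:R).
Proof.
have h0 : has_integral (normal_prob (0 : R) 1) (fun=> 1) 1.
  apply/has_integral_normal_prob; first exact: measurable_cst.
  under eq_fun do rewrite mul1r.
  by split; [exact: integrable_normal_pdf|exact: integral_normal_pdf].
have h2 : has_integral (normal_prob (0 : R) 1) (fun x => x ^+ 2) 1.
  apply/has_integral_normal_prob; first exact: measurable_funX.
  apply: eq_has_integral (@has_integral_quartic_normal_pdf R 0 1 0 0 1 0 0
    (oner_neq0 _)).
    by move=> x; rewrite subr0; ring.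
  by ring.
have := @has_integral_sum _ _ R (std_gaussian n) _ (index_enum 'I_n)
  (fun i (x : 'rV[R]_n) => x ord0 i ^+ 2 + a) (fun=> 1 + a).
rewrite sumr_const card_ord mulr_natr; apply => i.
(* A function of coordinate [i] alone is written as a product with factor [1] elsewhere, to fit the
   product formula. *)
have hi : forall j : 'I_n, has_integral (normal_prob (0 : R) 1)
  (fun t => if j == i then t ^+ 2 + a else 1) (if j == i then 1 + a else 1).
  move=> j; case: ifP => _ //.
  apply: has_integralD h2 _.
  by apply: eq_has_integral (has_integralZ a h0) => [x|]; rewrite mulr1.
apply: eq_has_integral (has_integral_std_gaussian_prod hi) => [x|].
  by rewrite -big_mkcond/= big_pred1_eq.
by rewrite -big_mkcond/= big_pred1_eq.
Qed.

Definition stein_kernel_sqr (x y : 'rV[R]_n) : R :=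
  (\sum_i (x ord0 i * y ord0 i - (2 * gamma + 4 * gamma ^+ 2) *
    (x ord0 i - y ord0 i) ^+ 2 + 2 * gamma)) ^+ 2 *
  \prod_i expR (- 2 * gamma * (x ord0 i - y ord0 i) ^+ 2).

Let mult (i j l : 'I_n) : nat := ((l == i) + (l == j))%N.

Let mult_le2 i j l : (mult i j l <= 2)%N.
Proof. by rewrite /mult; case: eqP; case: eqP. Qed.

Let prod_mult (F : nat -> 'I_n -> R) i j : (forall l, F 0 l = 1) ->
  \prod_l F (mult i j l) l = if i == j then F 2 i else F 1 i * F 1 j.
Proof.
move=> F0; rewrite (bigD1 i)//= /mult eqxx; have [<-|ij] := eqVneq i j.
  by rewrite big1 ?mulr1// => l /negPf ->.
rewrite /= (bigD1 j) 1?eq_sym//= eqxx (negPf ij).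
by rewrite big1 ?mulr1// => l /andP[/negPf -> /negPf ->].
Qed.

Lemma stein_kernel_sqrE x y : stein_kernel_sqr x y =
  \sum_i \sum_j \prod_l stein_factor gamma (mult i j l) (x ord0 l) (y ord0 l).
Proof.
rewrite /stein_kernel_sqr expr2 mulr_suml mulr_suml; apply: eq_bigr => i _.
rewrite mulr_sumr mulr_suml; apply: eq_bigr => j _.
rewrite /stein_factor big_split/=; congr (_ * _).
rewrite (@prod_mult (fun m l => (x ord0 l * y ord0 l -
  (2 * gamma + 4 * gamma ^+ 2) * (x ord0 l - y ord0 l) ^+ 2 + 2 * gamma) ^+ m)).
  by case: eqP => [->|_]; rewrite ?expr1 ?expr2.
by move=> l; rewrite expr0.
Qed.

Lemma stein_kernel_sqr_integral : exists I : 'rV[R]_n -> R,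
  (forall x, has_integral (std_gaussian n) (stein_kernel_sqr x) (I x)) /\
  has_integral (std_gaussian n) I
    ((1 + 8 * gamma) `^ (- (n%:R / 2)) *
           (n%:R / (1 + 8 * gamma) ^+ 2) *
           ((64 * gamma ^+ 4 + 32 * gamma ^+ 3 + 4 * gamma ^+ 2) * n%:R
            + 128 * gamma ^+ 4 + 128 * gamma ^+ 3 + 80 * gamma ^+ 2
            + 16 * gamma + 1)).
Proof.
have [b [b1 b2]] := stein_factor_moments gamma0.
exists (fun x => \sum_i \sum_j \prod_l b (mult i j l) (x ord0 l)); split.
  move=> x; apply: (eq_has_integral (fun y => esym (stein_kernel_sqrE x y))
    erefl).
  apply: has_integral_sum => i; apply: has_integral_sum => j.
  apply: (@has_integral_std_gaussian_prod R n
    (fun l => stein_factor gamma (mult i j l) (x ord0 l))) => l.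
  exact/b1/mult_le2.
set r1 := 2 * gamma * (1 + 4 * gamma) / (1 + 8 * gamma) in b2.
set r2 := r1 ^+ 2 + _ in b2.
pose r m := match m with 0 => 1 | 1 => r1 | _ => r2 end.
have S0 : 0 < 1 + 8 * gamma by rewrite addr_gt0// mulr_gt0.
have h : has_integral (std_gaussian n)
   (fun x => \sum_i \sum_j \prod_l b (mult i j l) (x ord0 l))
   (\sum_i \sum_j \prod_l (Num.sqrt (1 + 8 * gamma)^-1 * r (mult i j l))).
  apply: has_integral_sum => i; apply: has_integral_sum => j.
  apply: (@has_integral_std_gaussian_prod R n (fun l => b (mult i j l))
    (fun l => Num.sqrt (1 + 8 * gamma)^-1 * r (mult i j l))) => l.
  exact/b2/mult_le2.
apply: eq_has_integral h => //.
have powE : (1 + 8 * gamma) `^ (- (n%:R / 2)) = Num.sqrt (1 + 8 * gamma)^-1 ^+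
  n.
  have -> : Num.sqrt (1 + 8 * gamma)^-1 = (1 + 8 * gamma) `^ (- 2^-1).
    by rewrite powRN powR12_sqrt ?(ltW S0)// sqrtrV ?(ltW S0).
  by rewrite -powR_mulrn ?powR_ge0// -powRrM mulNr [n%:R / 2]mulrC.
rewrite powE.
(* Every coordinate contributes one normalising factor; beyond these, an off-diagonal pair gives
   [r1 ^+ 2] and a diagonal one [r2]. *)
transitivity (Num.sqrt (1 + 8 * gamma)^-1 ^+ n *
    \sum_(i < n) \sum_(j < n) (r1 ^+ 2 + (i == j)%:R * (r2 - r1 ^+ 2))).
  rewrite mulr_sumr; apply: eq_bigr => i _; rewrite mulr_sumr;
    apply: eq_bigr => j _.
  rewrite big_split/= prodr_const card_ord (@prod_mult (fun m _ => r m) i j)//.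
  by case: eqP => _ /=; rewrite /r; ring.
have sumE : \sum_(i < n) \sum_(j < n) (r1 ^+ 2 + (i == j)%:R * (r2 - r1 ^+ 2)) =
    n%:R ^+ 2 * r1 ^+ 2 + n%:R * (r2 - r1 ^+ 2).
  transitivity (\sum_(i < n) (n%:R * r1 ^+ 2 + (r2 - r1 ^+ 2))).
    apply: eq_bigr => i _; rewrite big_split/= sumr_const card_ord mulr_natl.
    congr (_ + _); rewrite (bigD1 i)//= eqxx mul1r big1 ?addr0//.
    by move=> j /negPf; rewrite eq_sym => ->; rewrite mul0r.
  by rewrite sumr_const card_ord -mulr_natl; ring.
rewrite sumE -mulrA; congr (_ * _).
(* By its form [r2 - r1 ^+ 2] is a polynomial over the square of [1 + 8 * gamma], so both sides
   become polynomials in the inverse of [1 + 8 * gamma]. *)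
rewrite /r2 addrAC subrr add0r /r1 -exprVn.
move: (1 + 8 * gamma)^-1 => u; ring.
Qed.

End stein_kernel_moments.

(** * The Gaussian reproducing kernel Hilbert space *)

Lemma cvg_big_sum {R : realType} I (r : seq I) (F : I -> nat -> R) (l : I -> R)
  :
  (forall i, F i n @[n --> \oo] --> l i) ->
  \sum_(i <- r) F i n @[n --> \oo] --> \sum_(i <- r) l i.
Proof.
move=> Fl; elim: r => [|i r IH].
  by rewrite big_nil; apply: cvg_near_cst; apply: nearW => n; rewrite big_nil.
rewrite big_cons (_ : (fun n => _) = (fun n => F i n + \sum_(j <- r) F j n)).
  exact: cvgD.
by apply/funext => n; rewrite big_cons.
Qed.

Section rkhs_hilbert.
Context {R : realType} {X : Type} {k : X -> X -> R} (H : rkhs k).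

Lemma rkhs_dotP a (x y z : H) : rkhs_dot H (a *: x + y) z = a * rkhs_dot H x z
  + rkhs_dot H y z.
Proof. by rewrite linearDl linearZl_LR. Qed.

Lemma rkhs_dotC (x y : H) : rkhs_dot H x y = rkhs_dot H y x.
Proof. by rewrite hermC expr0 mul1r. Qed.

Lemma rkhs_hilbert_dot : hilbert_dot (rkhs_dot H).
Proof.
split => [||x|x|u uC].
- exact: rkhs_dotC.
- exact: rkhs_dotP.
- by rewrite rkhs_dot_norm sqr_ge0.
- by rewrite rkhs_dot_norm => /eqP; rewrite sqrf_eq0 normr_eq0 => /eqP.
have : cauchy (u @ \oo).
  apply/cauchyP => e e0; have [N hN] := uC (e ^+ 2) (exprn_gt0 2 e0).
  exists (u N); exists N => // n /= Nn; rewrite -ball_normE/=.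
  by have := hN _ _ (leqnn N) Nn;
    rewrite rkhs_dot_norm ltr_pXn2r// nnegrE// ltW.
move=> /cauchy_cvgP/cvg_ex[/= l ul]; exists l.
have h : `|u n - l| @[n --> \oo] --> (0 : R).
  have := cvg_norm (cvgB ul (cvg_cst l)); rewrite subrr normr0; exact.
have -> : (fun n => rkhs_dot H (u n - l) (u n - l)) = (fun n => `|u n - l| *
  `|u n - l|).
  by apply/funext => n; rewrite rkhs_dot_norm expr2.
by rewrite -[X in _ --> X](mulr0 (0 : R)); exact: cvgM.
Qed.

Lemma rkhs_fun_dot (f : H) x : rkhs_fun f x = rkhs_dot H f (rkhs_section H x).
Proof. exact: rkhs_reproducing. Qed.

Lemma rkhs_dot_section x y : rkhs_dot H (rkhs_section H x) (rkhs_section H y) =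
  k x y.
Proof. by rewrite -rkhs_reproducing rkhs_sectionE. Qed.

End rkhs_hilbert.

Section rkhs_power.
Context {R : realType} {d : nat} {k : 'rV[R]_d -> 'rV[R]_d -> R} (H : rkhs k).
Local Notation dot := (@rkhs_pow_dot R d k H).

Lemma rkhs_pow_hilbert_dot : hilbert_dot dot.
Proof.
have HH := rkhs_hilbert_dot H.
split => [x y|a x y z|x|x|u uC].
- by apply: eq_bigr => i _; rewrite (hdotC HH).
- rewrite /rkhs_pow_dot mulr_sumr -big_split/=; apply: eq_bigr => i _.
  by rewrite !ffunE (hdotP HH).
- by apply: sumr_ge0 => i _; exact: (hdot_ge0 HH).
- move=> x0; apply/ffunP => i; rewrite ffunE; apply: (hdot_eq0 HH).
  move: x0; rewrite /rkhs_pow_dot => /eqP; rewrite psumr_eq0; last first.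
    by move=> j _; exact: (hdot_ge0 HH).
  by move=> /allP/(_ i (mem_index_enum _))/eqP.
have ex i : exists l, rkhs_dot H (u n i - l) (u n i - l) @[n --> \oo] --> (0 :
  R).
  apply: (hdot_complete HH) => e e0; have [N hN] := uC e e0.
  exists N => m n Nm Nn; apply: le_lt_trans (hN _ _ Nm Nn).
  rewrite /rkhs_pow_dot (bigD1 i)//= !ffunE lerDl; apply: sumr_ge0 => j _.
  exact: (hdot_ge0 HH).
have [l hl] := choice ex.
exists [ffun i => l i].
suff : \sum_i rkhs_dot H (u n i - l i) (u n i - l i) @[n --> \oo] --> (0 : R).
  apply: cvg_trans; apply: near_eq_cvg; apply: nearW => n.
  by apply: eq_bigr => i _; rewrite !ffunE.
rewrite [X in _ --> X](_ : _ = \sum_(i < d) (0 : R)); last by rewrite big1.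
exact: cvg_big_sum.
Qed.

End rkhs_power.

(** * Derivatives along lines and along the steps [n.+1%:R^-1] *)

Section difference_quotients.
Context {R : realType}.

Lemma cvg_difference_quotient (G : R -> R) (l : R) : is_derive (0 : R) (1 : R)
  G l ->
  n.+1%:R * (G n.+1%:R^-1 - G 0) @[n --> \oo] --> l.
Proof.
move=> [dG GE].
have : (h^-1 *: (G (h *: 1 + 0) - G 0) @[h --> 0^'] --> l) by rewrite -GE;
  exact: dG.
move/cvgr_dnbhsP => /(_ (fun n => n.+1%:R^-1)) h.
have {}h : n.+1%:R^-1^-1 *: (G (n.+1%:R^-1 *: 1 + 0) - G 0) @[n --> \oo] --> l.
  apply: h; split; last exact: cvg_harmonic.
  by move=> n; rewrite invr_eq0 pnatr_eq0.
apply: cvg_trans h; apply: near_eq_cvg; apply: nearW => n /=.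
by rewrite invrK addr0 /GRing.scale/= mulr1.
Qed.

Lemma derive_along (W : normedModType R) (f : W -> R) (v a : W) :
  'D_v f a = 'D_1 (fun t : R => f (t *: v + a)) 0.
Proof.
have E : (fun h : R => h^-1 *: ((f \o shift a) (h *: v) - f a)) =
    (fun h : R => h^-1 *: (((fun t : R => f (t *: v + a)) \o shift 0) (h *: 1) -
      (fun t : R => f (t *: v + a)) 0)).
  apply/funext => h /=; by rewrite addr0 scale0r add0r /GRing.scale/= mulr1.
by rewrite /derive E.
Qed.

End difference_quotients.

(** * Shifts and derivatives of the kernel, and the Gaussian score *)

Section gaussian_kernel_theory.
Context {R : realType} (d : nat) (gamma : R).
Local Notation k := (@gaussian_kernel R d gamma).
Local Notation e i := (delta_mx ord0 i : 'rV[R]_d).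
Implicit Types (x y : 'rV[R]_d) (i : 'I_d) (s t : R).

Lemma gaussian_kernelE x y :
  k x y = expR (- gamma * \sum_i (x ord0 i - y ord0 i) ^+ 2).
Proof.
rewrite /gaussian_kernel /norm2 sqr_sqrtr; last first.
  by apply: sumr_ge0 => i _; exact: sqr_ge0.
by congr (expR (_ * _)); apply: eq_bigr => i _; rewrite !mxE.
Qed.

Lemma gaussian_kernelC x y : k x y = k y x.
Proof.
rewrite !gaussian_kernelE; congr (expR (_ * _)); apply: eq_bigr => i _.
by rewrite -sqrrN opprB.
Qed.

Lemma gaussian_kernel_diag x : k x x = 1.
Proof.
rewrite gaussian_kernelE big1 ?mulr0 ?expR0// => i _.
by rewrite subrr expr0n.
Qed.

Lemma shift_coord x i t j : (t *: e i + x) ord0 j = t *+ (j == i) + x ord0 j.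
Proof. by rewrite !mxE eqxx/= mulr_natr. Qed.

Lemma gaussian_kernel_shift x y i t :
  k (t *: e i + x) y = k x y * expR (- gamma * (2 * t * (x ord0 i - y ord0 i) +
    t ^+ 2)).
Proof.
rewrite !gaussian_kernelE -expRD -mulrDr; congr (expR (_ * _)).
rewrite (bigD1 i)//= [in RHS](bigD1 i)//= shift_coord eqxx mulr1n.
rewrite (eq_bigr (fun j => (x ord0 j - y ord0 j) ^+ 2)); first by ring.
by move=> j /negPf ji; rewrite shift_coord ji mulr0n add0r.
Qed.

Lemma gaussian_kernel_shift_shift x i s t :
  k (s *: e i + x) (t *: e i + x) = expR (- gamma * (s - t) ^+ 2).
Proof.
rewrite gaussian_kernel_shift gaussian_kernelC gaussian_kernel_shift.
rewrite gaussian_kernel_diag mul1r -expRD shift_coord eqxx mulr1n.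
by congr expR; ring.
Qed.

Lemma is_derive_gaussian_kernel_shift x y i :
  is_derive (0 : R) (1 : R) (fun t => k (t *: e i + x) y)
    (- 2 * gamma * (x ord0 i - y ord0 i) * k x y).
Proof.
under eq_fun do rewrite gaussian_kernel_shift.
apply: is_derive_eq; rewrite /GRing.scale/=.
rewrite mulr0 mul0r !expr0n/= addr0 mulr0 expR0; ring.
Qed.

Lemma grad_gaussian_kernel x y i :
  grad (k^~ y) x ord0 i = - 2 * gamma * (x ord0 i - y ord0 i) * k x y.
Proof.
by rewrite /grad mxE derive_along; apply: derive_val;
  exact: is_derive_gaussian_kernel_shift.
Qed.

(** The mixed second derivative of the kernel, one derivative in each argument: the differentiated
    function is the pairing of the derivative feature at [y] with a moving kernel section. *)
Lemma is_derive_gaussian_kernel_shift2 x y i :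
  is_derive (0 : R) (1 : R)
   (fun t => - 2 * gamma * (y ord0 i - (t *: e i + x) ord0 i) * k y (t *: e i +
     x))
   ((2 * gamma - 4 * gamma ^+ 2 * (x ord0 i - y ord0 i) ^+ 2) * k x y).
Proof.
under eq_fun do rewrite gaussian_kernelC gaussian_kernel_shift shift_coord eqxx
  mulr1n.
apply: is_derive_eq; rewrite /GRing.scale/=.
rewrite mulr0 mul0r !expr0n/= addr0 mulr0 expR0; ring.
Qed.

Lemma score_std_gaussian x i : score (@std_gaussian_pdf R d) x ord0 i = - x
  ord0 i.
Proof.
have pdf0 y : 0 < std_gaussian_pdf y.
  by apply: prodr_gt0 => j _;
    rewrite normal_pdfE ?oner_eq0// mulr_gt0 ?expR_gt0// normal_peak_gt0.
have E t : std_gaussian_pdf (t *: e i + x) =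
    std_gaussian_pdf x * expR (- t * x ord0 i - t ^+ 2 / 2).
  rewrite /std_gaussian_pdf (bigD1 i)//= [in RHS](bigD1 i)//= shift_coord eqxx
    mulr1n.
  rewrite (eq_bigr (fun j => normal_pdf 0 1 (x ord0 j))); last first.
    by move=> j /negPf ji; rewrite shift_coord ji mulr0n add0r.
  rewrite [RHS]mulrAC; congr (_ * _); rewrite normal_pdfE ?oner_eq0// -mulrA.
  congr (_ * _); rewrite /normal_fun -expRD; congr expR.
  by field.
rewrite /score /grad mxE derive_along; apply: derive_val.
under eq_fun do rewrite E lnM ?posrE ?expR_gt0// expRK.
apply: is_derive_eq; rewrite /GRing.scale/=.
ring.
Qed.

End gaussian_kernel_theory.

(** * Partial derivatives of the kernel as elements of the space *)

Section kernel_derivative_features.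
Context {R : realType} (d : nat) (gamma : R).
Hypothesis gamma0 : 0 < gamma.
Variable H : rkhs (@gaussian_kernel R d gamma).
Local Notation k := (@gaussian_kernel R d gamma).
Local Notation e i := (delta_mx ord0 i : 'rV[R]_d).
Local Notation dot := (rkhs_dot H).
Local Notation sec := (rkhs_section H).
Implicit Types (x y : 'rV[R]_d) (i : 'I_d) (f g : H).

Let HH := rkhs_hilbert_dot H.

Let quot i x n : H := n.+1%:R *: (sec (n.+1%:R^-1 *: e i + x) - sec x).

Let kappa (s : R) := expR (- gamma * s ^+ 2).

(* <quot m, quot n> = m (1 - kappa s) * n (1 - kappa t)
     + kappa s * kappa t * m n (exp (2 gamma s t) - 1), s = 1 / m, t = 1 / n *)
Let dot_quot i x m n : `|dot (quot i x m) (quot i x n) - 2 * gamma| <=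
  (5 * gamma ^+ 2 + 4 * gamma ^+ 2 * expR (2 * gamma)) *
  Num.max m.+1%:R^-1 n.+1%:R^-1.
Proof.
set s := m.+1%:R^-1; set t := n.+1%:R^-1; set D := Num.max s t.
have s0 : 0 < s by rewrite invr_gt0.
have t0 : 0 < t by rewrite invr_gt0.
have sD : s <= D by rewrite le_max lexx.
have tD : t <= D by rewrite le_max lexx orbT.
have D0 : 0 < D by exact: lt_le_trans sD.
have D1 : D <= 1 by rewrite ge_max !invf_le1// !ler1n.
have mE : m.+1%:R = s^-1 :> R by rewrite /s invrK.
have nE : n.+1%:R = t^-1 :> R by rewrite /t invrK.
have k1 (u : R) : 1 - gamma * u ^+ 2 <= kappa u.
  by have := expR_ge1Dx (- gamma * u ^+ 2); rewrite /kappa; lra.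
have k2 (u : R) : kappa u <= 1.
  by rewrite -expR0 ler_expR mulNr oppr_le0 mulr_ge0 ?sqr_ge0// ltW.
pose z := 2 * gamma * s * t.
have z0 : 0 <= z by rewrite !mulr_ge0// ltW.
have ez1 := expR_ge1Dx z.
(* From [1 - z <= expR (- z)], multiplied by [expR z]. *)
have ez2 : expR z - 1 <= z * expR z.
  have := expR_ge1Dx (- z); rewrite expRN => h.
  by have := ler_wpM2r (expR_ge0 z) h; rewrite mulVf ?gt_eqF ?expR_gt0//; lra.
have ez3 : expR z <= expR (2 * gamma).
  rewrite ler_expR /z -mulrA; apply: ler_piMr;
    first by rewrite mulr_ge0 ?(ltW gamma0).
  by apply: mulr_ile1; rewrite ?(ltW s0) ?(ltW t0)// ?(le_trans sD)// (le_trans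
    tD).
have zD : z <= 2 * gamma * D.
  rewrite /z -mulrA ler_wpM2l ?mulr_ge0 ?(ltW gamma0)//.
  by rewrite (le_trans _ sD)// ler_piMr ?(ltW s0)// (le_trans tD).
have -> : dot (quot i x m) (quot i x n) =
    s^-1 * (1 - kappa s) * (t^-1 * (1 - kappa t)) +
    kappa s * kappa t * ((expR z - 1) / (s * t)).
  rewrite /quot -/s -/t mE nE (hdotZl HH) (hdotZr HH) (hdotBl HH) !(hdotBr HH).
  rewrite !rkhs_dot_section gaussian_kernel_shift_shift.
  rewrite (gaussian_kernelC _ x) !gaussian_kernel_shift gaussian_kernel_diag.
  rewrite subrr !mulr0 !add0r !mul1r -/(kappa s) -/(kappa t).
  have -> : expR (- gamma * (s - t) ^+ 2) = kappa s * kappa t * expR z.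
    by rewrite -!expRD; congr expR; rewrite /z; ring.
  by field; rewrite !gt_eqF.
have A u : 0 < u -> u <= D -> 0 <= u^-1 * (1 - kappa u) <= gamma * D.
  move=> u0 uD; apply/andP; split.
    by apply: mulr_ge0; rewrite ?invr_ge0 ?subr_ge0// ltW.
  rewrite ler_pdivrMl//.
  apply: (@le_trans _ _ (gamma * u ^+ 2)); first by have := k1 u; lra.
  by rewrite expr2 mulrCA ler_wpM2l ?(ltW u0)// ler_wpM2l ?(ltW gamma0).
have /andP[As1 As2] := A s s0 sD; have /andP[At1 At2] := A t t0 tD.
set P := s^-1 * (1 - kappa s) in As1 As2 *.
set Q := t^-1 * (1 - kappa t) in At1 At2 *.
have PQ0 : 0 <= P * Q by exact: mulr_ge0.
have PQ1 : P * Q <= gamma ^+ 2 * D.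
  apply: (@le_trans _ _ (gamma * D * (gamma * D))); first exact: ler_pM.
  rewrite (_ : gamma * D * (gamma * D) = gamma ^+ 2 * D * D); last by ring.
  by rewrite ler_piMr// mulr_ge0 ?sqr_ge0// ltW.
set W := (expR z - 1) / (s * t).
have st0 : 0 < s * t by exact: mulr_gt0.
have W1 : 2 * gamma <= W.
  by rewrite ler_pdivlMr// mulrA -/z; move: ez1; lra.
have W2 : W <= 2 * gamma * expR z.
  rewrite ler_pdivrMr// (le_trans ez2)// /z.
  by rewrite le_eqVlt; apply/orP; left; apply/eqP; ring.
have W3 : W <= 2 * gamma + 4 * gamma ^+ 2 * expR (2 * gamma) * D.
  apply: (le_trans W2).
  have h1 : z * expR z <= 2 * gamma * D * expR (2 * gamma).
    by apply: ler_pM => //; exact: expR_ge0.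
  have h2 := ler_wpM2l (ltW gamma0) (le_trans ez2 h1); lra.
have kk1 : kappa s * kappa t <= 1 by rewrite mulr_ile1 ?expR_ge0.
have kk0 : 0 <= kappa s * kappa t by rewrite mulr_ge0 ?expR_ge0.
have kk2 : 1 - 2 * gamma * D <= kappa s * kappa t.
  rewrite /kappa -expRD; apply: le_trans (expR_ge1Dx _).
  have hs : gamma * s ^+ 2 <= gamma * D.
    by rewrite ler_wpM2l ?(ltW gamma0)// expr2 (le_trans _ sD)// ler_piMr ?(ltW
      s0)// (le_trans sD).
  have ht : gamma * t ^+ 2 <= gamma * D.
    by rewrite ler_wpM2l ?(ltW gamma0)// expr2 (le_trans _ tD)// ler_piMr ?(ltW
      t0)// (le_trans tD).
  lra.
have g2D : 0 <= gamma ^+ 2 * D by rewrite mulr_ge0 ?sqr_ge0// ltW.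
have geD : 0 <= gamma ^+ 2 * expR (2 * gamma) * D.
  by rewrite !mulr_ge0 ?sqr_ge0 ?expR_ge0// ltW.
have up : kappa s * kappa t * W <= W.
  by rewrite ler_piMl// (le_trans _ W1)// mulr_ge0// ltW.
have low : (1 - 2 * gamma * D) * (2 * gamma) <= kappa s * kappa t * W.
  apply: (@le_trans _ _ (kappa s * kappa t * (2 * gamma))).
    by rewrite ler_wpM2r// mulr_ge0// ltW.
  by rewrite ler_wpM2l.
(* The excess over [2 * gamma] is at most [D] times [gamma ^+ 2 + 4 * gamma ^+ 2 * expR (2 *
   gamma)], the deficit at most [4 * gamma ^+ 2 * D]; the stated constant covers both. *)
by rewrite ler_norml; apply/andP; split; lra.
Qed.

(** Inner products of two quotients tend jointly to [2 * gamma], the mixed derivative of the kernel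
    on the diagonal, so the quotients converge in norm. *)
Lemma kernel_derivative_exists i x : exists D : H,
  dot (quot i x n - D) (quot i x n - D) @[n --> \oo] --> (0 : R).
Proof.
apply: (hdot_cvg_of_mixed HH (L := 2 * gamma)) => eps eps0.
set C := 5 * gamma ^+ 2 + 4 * gamma ^+ 2 * expR (2 * gamma).
have C0 : 0 < C by rewrite addr_gt0// ?mulr_gt0// ?expR_gt0// exprn_gt0.
exists (Num.trunc (C / eps)) => m n Nm Nn.
apply: (le_lt_trans (dot_quot i x m n)); rewrite -/C -ltr_pdivlMl//.
have h p : (Num.trunc (C / eps) <= p)%N -> p.+1%:R^-1 < C^-1 * eps.
  move=> Np; rewrite invf_plt ?posrE ?mulr_gt0 ?invr_gt0// invfM invrK.
  by rewrite (lt_le_trans (truncnS_gt _))// ler_nat ltnS.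
by rewrite gt_max !h.
Qed.

(** Pairing the norm limit with a fixed element gives a limit of scalar difference quotients.
    Calculus computes the same limits, first against kernel sections, then, using that result,
    against the derivatives themselves. *)
Lemma kernel_derivative_features : exists D : 'I_d -> 'rV[R]_d -> H,
  [/\ forall i x f, n.+1%:R * (rkhs_fun f (n.+1%:R^-1 *: e i + x) - rkhs_fun f
    x)
        @[n --> \oo] --> dot f (D i x),
      forall i x y, dot (D i x) (sec y) = - 2 * gamma * (x ord0 i - y ord0 i) *
        k x y &
      forall i x y, dot (D i x) (D i y) =
        (2 * gamma - 4 * gamma ^+ 2 * (x ord0 i - y ord0 i) ^+ 2) * k x y].
Proof.
have [D' hD'] := choice (fun ix : 'I_d * 'rV[R]_d => kernel_derivative_exists
  ix.1 ix.2).
pose D i x := D' (i, x).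
have Dcvg i x f : n.+1%:R * (rkhs_fun f (n.+1%:R^-1 *: e i + x) - rkhs_fun f x)
        @[n --> \oo] --> dot f (D i x).
  have := hdot_cvg HH (y := f) (hD' (i, x)); rewrite (hdotC HH (D' _)).
  apply: cvg_trans; apply: near_eq_cvg; apply: nearW => n /=.
  by rewrite (hdotZl HH) (hdotBl HH) !rkhs_fun_dot !(hdotC HH f).
have Dsec i x y : dot (D i x) (sec y) = - 2 * gamma * (x ord0 i - y ord0 i) * k
  x y.
  rewrite (hdotC HH); apply: (norm_cvg_unique (Dcvg i x (sec y))).
  have := cvg_difference_quotient (is_derive_gaussian_kernel_shift gamma x y i).
  apply: cvg_trans; apply: near_eq_cvg; apply: nearW => n /=.
  by rewrite !rkhs_fun_dot !rkhs_dot_section !(gaussian_kernelC _ y) scale0r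
    add0r.
exists D; split => // i x y.
rewrite (hdotC HH); apply: (norm_cvg_unique (Dcvg i x (D i y))).
have := cvg_difference_quotient (is_derive_gaussian_kernel_shift2 gamma x y i).
apply: cvg_trans; apply: near_eq_cvg; apply: nearW => n /=.
by rewrite !rkhs_fun_dot !Dsec scale0r add0r.
Qed.

End kernel_derivative_features.

(** * Rounding to a countable grid *)

Section grid_rounding.
Context {R : realType} (d : nat).

(** The grid of mesh [n.+1%:R^-1] has two uses: rounding to it approximates members of the space by
    measurable step functions, and its points yield a countable separating family. *)
Definition grid_point (n : nat) (z : {ffun 'I_d -> int}) : 'rV[R]_d :=
  \row_i ((z i)%:~R / n.+1%:R).

Definition grid_floor (n : nat) (x : 'rV[R]_d) : {ffun 'I_d -> int} :=
  [ffun i => Num.floor (n.+1%:R * x ord0 i)].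

Lemma grid_point_floor n (x : 'rV[R]_d) i :
  `|grid_point n (grid_floor n x) ord0 i - x ord0 i| <= n.+1%:R^-1.
Proof.
rewrite mxE ffunE; set y := n.+1%:R * x ord0 i.
have -> : x ord0 i = y / n.+1%:R by rewrite /y mulrAC divff ?mul1r// pnatr_eq0.
rewrite -mulrBl normrM [X in _ * X]ger0_norm// ler_piMl//.
rewrite ler0_norm ?subr_le0 ?ge_floor// opprB lerBlDr addrC.
by rewrite ltW// -[X in _ + X](mulr1z 1) -intrD; exact: floorD1_gt.
Qed.

Lemma measurable_grid_floor n (g : {ffun 'I_d -> int} -> R) :
  measurable_fun [set: 'rV[R]_d] (fun x => g (grid_floor n x)).
Proof.
move=> _ Y mY; rewrite setTI.
(* Rounding takes countably many values, and each fibre is a finite intersection of coordinate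
   slabs. *)
have -> : (fun x => g (grid_floor n x)) @^-1` Y =
    \bigcup_z ([set _ | Y (g z)] `&` \bigcap_(i in [set: 'I_d])
      [set x : 'rV[R]_d | Num.floor (n.+1%:R * x ord0 i) = z i]).
  apply/seteqP; split=> [x /= Yx|x [z _ [/= Yz zx]]].
    by exists (grid_floor n x) => //; split => // i _ /=; rewrite ffunE.
  by rewrite /preimage/= (_ : grid_floor n x = z)//; apply/ffunP => i;
    rewrite ffunE; exact: zx.
apply: countable_bigcupT_measurable => // z; apply: measurableI.
  have [Yz|Yz] := pselect (Y (g z)).
    by rewrite (_ : mkset _ = setT)//; apply/seteqP; split.
  by rewrite (_ : mkset _ = set0)//; apply/seteqP; split.
apply: fin_bigcap_measurable => [|i _]; first exact: finite_finset.
have mi : measurable_fun [set: 'rV[R]_d] (fun x => n.+1%:R * x ord0 i : R).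
  by apply: measurable_funM => //; exact: measurable_coord.
have -> : [set x : 'rV[R]_d | Num.floor (n.+1%:R * x ord0 i) = z i] =
    [set: 'rV[R]_d] `&` (fun x => n.+1%:R * x ord0 i) @^-1` `[(z i)%:~R, (z i +
      1)%:~R[%classic.
  rewrite setTI; apply/seteqP; split=> x /=; rewrite in_itv/=.
    by move=> <-; rewrite ge_floor floorD1_gt.
  by move=> /floor_def.
exact: mi.
Qed.

End grid_rounding.

(** * Measurability, separability and the Stein feature for the Gaussian kernel *)

Section gaussian_rkhs.
Context {R : realType} (d : nat) (gamma : R).
Hypothesis gamma0 : 0 < gamma.
Variable H : rkhs (@gaussian_kernel R d gamma).
Local Notation k := (@gaussian_kernel R d gamma).
Local Notation e i := (delta_mx ord0 i : 'rV[R]_d).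
Local Notation dot := (rkhs_dot H).
Local Notation sec := (rkhs_section H).
Local Notation V := {ffun 'I_d -> H}.
Local Notation pdot := (@rkhs_pow_dot R d _ H).
Implicit Types (x y : 'rV[R]_d) (i : 'I_d) (f g : H).

Let HH := rkhs_hilbert_dot H.

(** By Cauchy-Schwarz the squared increment of [f] is at most [dot f f * (2 - 2 * k u x)]. Since
    [1 - k u x] is at most [gamma] times the squared Euclidean distance, the mesh bounds it by
    [gamma * d%:R / n.+1%:R]. *)
Lemma rkhs_fun_grid_cvg f x :
  rkhs_fun f (grid_point n (grid_floor n x)) @[n --> \oo] --> rkhs_fun f x.
Proof.
pose C := dot f f * (2 * gamma * d%:R).
apply: (cvg_of_sqr_le (g := fun n => C * n.+1%:R^-1)); last first.
  by rewrite -[X in _ --> X](mulr0 C); apply: cvgMr; exact: cvg_harmonic.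
move=> n; set u := grid_point _ _.
rewrite !rkhs_fun_dot -(hdotBr HH).
apply: (le_trans (hdot_CauchySchwarz HH _ _)).
rewrite /C -mulrA; apply: ler_wpM2l; first exact: (hdot_ge0 HH).
rewrite (hdotBl HH) !(hdotBr HH) !rkhs_dot_section !gaussian_kernel_diag.
rewrite (gaussian_kernelC _ x u).
have : 1 - gamma * (d%:R * n.+1%:R^-1) <= k u x.
  rewrite gaussian_kernelE; apply: le_trans (expR_ge1Dx _).
  rewrite lerD2l mulNr lerN2 ler_wpM2l ?(ltW gamma0)//.
  have -> : d%:R * n.+1%:R^-1 = \sum_(i < d) (n.+1%:R^-1 : R).
    by rewrite sumr_const card_ord mulr_natl.
  apply: ler_sum => i _; have h := grid_point_floor n x i.
  rewrite -real_normK ?num_real// expr2.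
  apply: (le_trans (ler_pM _ _ h h)) => //.
  by rewrite ler_piMr// invf_le1// ler1n.
by rewrite -(mulrA (2 * gamma)); move: (k u x) (d%:R / n.+1%:R) => z w h; lra.
Qed.

Lemma measurable_rkhs_fun f : measurable_fun [set: 'rV[R]_d] (rkhs_fun f).
Proof.
have mF n : measurable_fun [set: 'rV[R]_d] (fun x => rkhs_fun f (grid_point n
  (grid_floor n x))).
  exact: (measurable_grid_floor n (fun z => rkhs_fun f (grid_point n z))).
apply: (measurable_fun_cvg mF) => x _; exact: rkhs_fun_grid_cvg.
Qed.

Lemma rkhs_fun0 x : rkhs_fun (0 : H) x = 0.
Proof. by rewrite rkhs_fun_dot (hdot0l HH). Qed.

(** Kernel sections at grid points, placed in one component at a time, form a countable family;
    orthogonality to it makes each component vanish on all grids, hence everywhere by grid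
    convergence. Integers that code no index are sent to [0]. *)
Lemma rkhs_pow_separating : exists q : nat -> V,
  forall f : V, (forall n, pdot f (q n) = 0) -> f = 0.
Proof.
pose I : countType := ('I_d * nat * {ffun 'I_d -> int})%type.
pose b (j : I) : V := [ffun i => if i == j.1.1 then sec (grid_point j.1.2 j.2)
  else 0].
exists (fun n => if (unpickle n : option I) is Some j then b j else 0) => f fq.
apply/ffunP => i; rewrite ffunE; apply: rkhs_fun_inj; apply/funext => x.
rewrite rkhs_fun0.
have f0 : rkhs_fun (f i) (grid_point n (grid_floor n x)) @[n --> \oo] --> (0 :
  R).
  apply: cvg_near_cst; apply: nearW => n.
  have := fq (pickle (i, n, grid_floor n x)); rewrite pickleK /rkhs_pow_dot.
  rewrite (bigD1 i)//= big1 ?addr0 => [|j /negPf ji]; last first.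
    by rewrite ffunE/= ji (hdot0r HH).
  by rewrite ffunE/= eqxx -rkhs_fun_dot.
exact: (norm_cvg_unique (@rkhs_fun_grid_cvg (f i) x) f0).
Qed.

Section with_features.
Variable D : 'I_d -> 'rV[R]_d -> H.
Hypothesis D_cvg : forall i x f,
  n.+1%:R * (rkhs_fun f (n.+1%:R^-1 *: e i + x) - rkhs_fun f x)
        @[n --> \oo] --> dot f (D i x).
Hypothesis D_section : forall i x y,
  dot (D i x) (sec y) = - 2 * gamma * (x ord0 i - y ord0 i) * k x y.
Hypothesis D_dot : forall i x y, dot (D i x) (D i y) =
        (2 * gamma - 4 * gamma ^+ 2 * (x ord0 i - y ord0 i) ^+ 2) * k x y.

Local Notation xi := (@stein_feature R d k H (@std_gaussian_pdf R d)).

(** The right side realises the function prescribed by the feature map, and [rkhs_fun_inj] makes it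
    the only such element, so [rkhs_lift] selects it instead of its default. *)
Lemma stein_feature_gaussian x i : xi x i = - x ord0 i *: sec x + D i x.
Proof.
rewrite ffunE /rkhs_lift; apply: xget_unique => [|h hE].
  apply/funext => y.
  rewrite rkhs_fun_lin !rkhs_fun_dot rkhs_dot_section D_section.
  by rewrite score_std_gaussian grad_gaussian_kernel.
apply: rkhs_fun_inj; rewrite hE; apply/funext => y.
rewrite rkhs_fun_lin !rkhs_fun_dot rkhs_dot_section D_section.
by rewrite score_std_gaussian grad_gaussian_kernel.
Qed.

(** The two cross terms between sections and derivatives combine to
    [- 2 * gamma * (x ord0 i - y ord0 i) ^+ 2]; the pairing of derivatives supplies the
    [4 * gamma ^+ 2] part and the constant [2 * gamma]. *)
Lemma stein_feature_dot x y : pdot (xi x) (xi y) =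
  (\sum_i (x ord0 i * y ord0 i - (2 * gamma + 4 * gamma ^+ 2) *
    (x ord0 i - y ord0 i) ^+ 2 + 2 * gamma)) * k x y.
Proof.
rewrite /rkhs_pow_dot mulr_suml; apply: eq_bigr => i _.
(* Rewriting with stein_feature_gaussian instead would make unification unfold
   the features of x and y against each other. *)
rewrite [LHS](congr2 dot (stein_feature_gaussian x i) (stein_feature_gaussian y
  i)).
rewrite (hdotDl HH) (hdotDr HH (_ *: sec y)) (hdotDr HH (_ *: sec y)).
rewrite (hdotZl HH) (hdotZl HH) (hdotZr HH) (hdotZr HH).
rewrite (D_dot i x y) (hdotC HH (sec x) (D i y)) (D_section i x y) (D_section i
  y x).
rewrite (rkhs_dot_section H x y) (gaussian_kernelC gamma y x).
move: (k x y) => c; ring.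
Qed.

Lemma stein_feature_sqnorm x : pdot (xi x) (xi x) =
  \sum_i (x ord0 i ^+ 2 + 2 * gamma).
Proof.
rewrite stein_feature_dot gaussian_kernel_diag mulr1; apply: eq_bigr => i _;
  ring.
Qed.

Lemma stein_feature_dot_sqr x y :
  pdot (xi x) (xi y) ^+ 2 = stein_kernel_sqr gamma x y.
Proof.
rewrite stein_feature_dot exprMn; congr (_ * _).
rewrite gaussian_kernelE -expRM_natl mulrA mulr_sumr expR_sum;
  apply: eq_bigr => i _.
by congr expR; ring.
Qed.

Lemma measurable_stein_feature (f : V) :
  measurable_fun [set: 'rV[R]_d] (fun x => pdot f (xi x)).
Proof.
rewrite /rkhs_pow_dot; apply: measurable_sum => i.
rewrite (_ : (fun x => _) = (fun x : 'rV[R]_d => - x ord0 i * rkhs_fun (f i) x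
  + dot (f i) (D i x))); last first.
  apply/funext => x.
  by rewrite stein_feature_gaussian (hdotDr HH) (hdotZr HH) rkhs_fun_dot.
apply: measurable_funD.
  apply: measurable_funM; last exact: measurable_rkhs_fun.
  by apply: measurableT_comp => //; exact: measurable_coord.
(* The derivative part is a pointwise limit of difference quotients of a measurable function. *)
have mF n : measurable_fun [set: 'rV[R]_d] (fun x : 'rV[R]_d =>
    n.+1%:R * (rkhs_fun (f i) (n.+1%:R^-1 *: e i + x) - rkhs_fun (f i) x)).
  apply: measurable_funM => //; apply: measurable_funB;
    last exact: measurable_rkhs_fun.
  apply: (measurableT_comp (measurable_rkhs_fun (f i))).
  apply: measurable_fun_row => j.
  under eq_fun do rewrite shift_coord.
  by apply: measurable_funD => //; exact: measurable_coord.
by apply: (measurable_fun_cvg mF) => x _; exact: D_cvg.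
Qed.

End with_features.

End gaussian_rkhs.

(** * Assembly: the covariance operator of the Gaussian Stein feature and its traces *)

Theorem proposition10 (R : realType) (d : nat) (gamma : R) (hgamma : 0 < gamma)
    (H : rkhs (@gaussian_kernel R d gamma)) :
  exists C : {ffun 'I_d -> H} -> {ffun 'I_d -> H},
    [/\ is_stein_covariance (std_gaussian d) (@std_gaussian_pdf R d) C,
        forall C' : {ffun 'I_d -> H} -> {ffun 'I_d -> H},
          is_stein_covariance (std_gaussian d) (@std_gaussian_pdf R d) C' ->
          C' = C,
        is_trace (@rkhs_pow_dot R d _ H) C ((1 + 2 * gamma) * d%:R) &
        is_trace (@rkhs_pow_dot R d _ H) (C \o C)
          ((1 + 8 * gamma) `^ (- (d%:R / 2)) *
           (d%:R / (1 + 8 * gamma) ^+ 2) *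
           ((64 * gamma ^+ 4 + 32 * gamma ^+ 3 + 4 * gamma ^+ 2) * d%:R
            + 128 * gamma ^+ 4 + 128 * gamma ^+ 3 + 80 * gamma ^+ 2
            + 16 * gamma + 1))].
Proof.
have [D [Dcvg Dsec Ddot]] := kernel_derivative_features hgamma H.
have [q sep] := rkhs_pow_separating hgamma H.
have HV := rkhs_pow_hilbert_dot H.
have mxi := measurable_stein_feature hgamma Dcvg Dsec.
have sqnorm := stein_feature_sqnorm Dsec Ddot.
(* The expected squared norm of the feature serves twice: its finiteness makes [C] exist, its value
   is the trace of [C]. *)
have [inorm enorm] := has_integral_std_gaussian_sqnorm d (2 * gamma).
have ixi : (std_gaussian d).-integrable [set: 'rV[R]_d] (fun x =>
    (rkhs_pow_dot (stein_feature H (@std_gaussian_pdf R d) x)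
      (stein_feature H (@std_gaussian_pdf R d) x))%:E).
  by under eq_fun do rewrite sqnorm.
have [C CE] := covariance_operator_exists HV sep mxi ixi.
exists C; split.
- exact: (covariance_operator_expectation HV mxi ixi CE).
- by move=> C'; exact: (covariance_operator_unique HV mxi ixi CE).
- apply: (trace_covariance_operator HV sep mxi ixi CE).
  by rewrite -enorm; apply: eq_integral => x _; rewrite sqnorm.
have [I [hI [_ eI]]] := stein_kernel_sqr_integral d hgamma.
apply: (trace_covariance_operator_sqr HV sep mxi ixi CE).
rewrite -eI; apply: eq_integral => x _; rewrite -(hI x).2.
by apply: eq_integral => y _; rewrite (stein_feature_dot_sqr Dsec Ddot).
Qed.
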